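(* Let $(\frac pq,\frac rs)$ be a Farey pair of order $n$ with $q<s$ and $\lfloor n/q\rfloor=1$, and for $\alpha\in[0,1]$, $\beta=1-\alpha$, let $f_\alpha(t)=t^s-\beta t^{s-q}-\alpha$. For every $\theta\in\arg(q,s)$ there exist unique $\rho\in(0,1]$ and $\alpha\in[0,1]$ such that $\rho e^{i\theta}$ is a root of $f_\alpha$. Furthermore, $\rho$ satisfies $$\rho^s\sin(q\theta)-\rho^q\sin(s\theta)+\sin((s-q)\theta)=0.$$ In particular, $\rho e^{i\theta}$ is the point of $\partial\Theta_n$ with argument $\theta$.
   Context: A matrix is stochastic if it is entrywise nonnegative with all row sums $1$; $\Theta_n$ is the set of all eigenvalues of all $n\times n$ stochastic matrices and $\partial\Theta_n$ its boundary. $\mathcal{F}_n=\{p/q:0\le p<q\le n,\ \gcd(p,q)=1\}$; a Farey pair of order $n$ is a pair $(\frac pq,\frac rs)$ of elements of $\mathcal F_n$ with $\frac pq<\frac rs$ and no element of $\mathcal F_n$ strictly between them. $\arg(q,s)=(\frac{2\pi p}{q},\frac{2\pi r}{s})\cup(\frac{2\pi(s-r)}{s},\frac{2\pi(q-p)}{q})$, arguments in $[0,2\pi)$. *)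

(* Defs.v *)
From HB Require Import structures.
From mathcomp Require Import all_boot all_order all_algebra.
From mathcomp Require Import complex.
From mathcomp Require Import reals trigo.
Set Implicit Arguments. Unset Strict Implicit. Unset Printing Implicit Defensive.
Import Order.TTheory GRing.Theory Num.Theory.
Local Open Scope ring_scope.

Definition stochastic (R : realType) (n : nat) (A : 'M[R]_n) : Prop :=
  (forall i j, 0 <= A i j) /\ (forall i, \sum_(j < n) A i j = 1).

Definition Theta (R : realType) (n : nat) (z : R[i]) : Prop :=
  exists A : 'M[R]_n, stochastic A /\ eigenvalue (map_mx (real_complex R) A) z.

Definition boundaryC (R : realType) (S : R[i] -> Prop) (z : R[i]) : Prop :=
  forall e : R, 0 < e ->
    (exists w, S w /\ `|w - z| < (e%:C)%C) /\ (exists w, ~ S w /\ `|w - z| < (e%:C)%C).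

Definition in_Farey (n p q : nat) : Prop := (p < q)%N /\ (q <= n)%N /\ coprime p q.

Definition farey_pair (n p q r s : nat) : Prop :=
  in_Farey n p q /\ in_Farey n r s /\ (p * s < r * q)%N /\
  forall a b : nat, in_Farey n a b -> ~ ((p * b < a * q)%N /\ (a * s < r * b)%N).

Definition arg_qs (R : realType) (p q r s : nat) (t : R) : Prop :=
  (2 * pi * p%:R / q%:R < t /\ t < 2 * pi * r%:R / s%:R) \/
  (2 * pi * (s - r)%:R / s%:R < t /\ t < 2 * pi * (q - p)%:R / q%:R).

Definition expi (R : realType) (t : R) : R[i] := (cos t +i* sin t)%C.

Definition f_alpha (R : realType) (q s : nat) (alpha : R) (z : R[i]) : R[i] :=
  z ^+ s - ((1 - alpha)%:C)%C * z ^+ (s - q) - (alpha%:C)%C.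

(* Main.v *)
(* For lambda = rho e^(i theta) in the first arc put A = q theta - 2 pi p and
   B = 2 pi r - s theta; then A, B > 0, A + B < pi and, as r q - p s = 1,
   q B + s A = 2 pi.  The displayed equation reads g(rho) = 0 with
   g(x) = x^s sin A + x^q sin B - sin (A + B) strictly increasing, which gives
   rho and alpha.  The point is that lambda is an eigenvalue of a stochastic
   matrix of size n iff g(rho) <= 0.

   If g(rho) <= 0, lambda lies between 0 and an eigenvalue of the stochastic
   companion matrix of f_alpha, and Theta_n is star-shaped about 0.

   If g(rho) > 0, scale the matrix to M with row sums t < 1 so that
   z = 1 / (t lambda) still satisfies Re nu > 1, where nu is the complex number
   with Re (nu z^q) = Re (nu z^s) = 1.  Expand det (1 - z M) along cycles: as
   n < 2 q there is at most one cycle of length at least q, hence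
     det (1 - z M) = F(V) - sum_(|X| >= q) beta(X) z^|X| F(V \ X),
   where F is the same determinant restricted to permutations with short cycles.
   By induction on U the quotients F(U') / F(U), compared with their values at
   z = 1, stay in a multiplicative "wedge" W of complex numbers such that
   Re (nu z^m w) <= 1 for all w in W and q <= m < q + s.  So det (1 - z M) = 0
   would make nu a subconvex combination of numbers with real part at most 1,
   contradicting Re nu > 1. *)
Require Import Defs.
From HB Require Import structures.
From mathcomp Require Import boolp classical_sets functions.
From mathcomp Require Import all_boot all_order all_fingroup all_algebra.
From mathcomp Require Import complex.
From mathcomp Require Import reals topology normedtype sequences derive realfun.
From mathcomp Require Import exp trigo.
From mathcomp Require Import ring lra zify.
Set Implicit Arguments. Unset Strict Implicit. Unset Printing Implicit Defensive.
Import Order.TTheory GRing.Theory Num.Theory numFieldNormedType.Exports.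
Local Open Scope ring_scope.

(** * Cycle expansion of the determinant *)

Section PermCycles.
Variable T : finType.
Implicit Types (s t c : {perm T}) (x y : T) (X Y U : {set T}) (k : nat).

Definition short k s := [forall x, #|porbit s x| < k]%N.

(** A fixed point counts as a cycle of length one: when [X] is empty or a singleton, only the
    identity qualifies. *)
Definition full_cycle X c := perm_on X c && [forall x in X, porbit c x == X].

Lemma porbit_eq_in s t Y x :
  {in Y, forall y, t y \in Y} -> {in Y, s =1 t} -> x \in Y -> porbit s x = porbit t x.
Proof.
move=> tY st xY.
have h k : (s ^+ k)%g x = (t ^+ k)%g x /\ (t ^+ k)%g x \in Y.
  elim: k => [|k [IH1 IH2]]; first by rewrite !expg0 !perm1.
  by rewrite !expgSr !permM IH1 st // tY.
apply/setP=> y; apply/porbitP/porbitP => -[k ->]; exists k; by case: (h k).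
Qed.

Lemma porbit_fix s x : s x = x -> porbit s x = [set x].
Proof.
move=> sx; apply/setP => y; rewrite inE; apply/porbitP/eqP => [[k ->]|->].
  elim: k => [|k IH]; first by rewrite expg0 perm1.
  by rewrite expgSr permM IH.
by exists 0%N; rewrite expg0 perm1.
Qed.

Lemma full_cycle_moves X c x :
  full_cycle X c -> (1 < #|X|)%N -> x \in X -> c x != x.
Proof.
case/andP=> _ /forall_inP cX X1 xX; apply/eqP => /porbit_fix cx.
by move: X1; rewrite -(eqP (cX _ xX)) cx cards1.
Qed.

(** The orbits of [c] are [X] and the singletons outside [X]; the parity is read off from the number
    of orbits. *)
Lemma full_cycle_odd X c : X != set0 -> full_cycle X c -> c = odd #|X|.-1 :> bool.
Proof.
move=> X0 /andP[cX /forall_inP cXX].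
have oX x : x \notin X -> porbit c x = [set x] by move=> ?; rewrite porbit_fix // (out_perm cX).
have E : porbits c = X |: [set [set x] | x in ~: X].
  apply/setP => Y; rewrite !inE; apply/imsetP/orP.
    move=> [x _ ->]; have [xX|xX] := boolP (x \in X); first by left; exact: cXX.
    by right; rewrite oX //; apply/imsetP; exists x; rewrite ?inE.
  case=> [/eqP->|/imsetP[x xX ->]].
    by have [x xX] := set0Pn _ X0; exists x => //; rewrite (eqP (cXX _ xX)).
  by exists x => //; rewrite oX //; rewrite inE in xX.
rewrite /odd_perm E cardsU1 card_imset; last exact: set1_inj.
have -> : X \notin [set [set x] | x in ~: X].
  apply/imsetP => -[x]; rewrite inE => /negP xX XE; apply: xX; rewrite XE; exact: set11.
have XT : (#|X| + #|~: X| = #|T|)%N by rewrite -(cardsC X).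
rewrite -XT !oddD /=.
have XS : #|X| = #|X|.-1.+1 by rewrite prednK // card_gt0.
rewrite XS /=.
by case: (odd _); case: (odd _).
Qed.

Section DisjointMul.
Variables (U X : {set T}) (c t : {perm T}).
Hypotheses (XU : X \subset U) (cX : perm_on X c) (tUX : perm_on (U :\: X) t).

Lemma disj_mul_in x : x \in X -> (c * t)%g x = c x.
Proof.
by move=> xX; rewrite permM (out_perm tUX) // !inE (perm_closed _ cX) xX.
Qed.

Lemma disj_mul_out x : x \notin X -> (c * t)%g x = t x.
Proof. by move=> xX; rewrite permM (out_perm cX). Qed.

Lemma disj_mul_perm_on : perm_on U (c * t)%g.
Proof.
apply: perm_onM; first exact: subset_trans cX XU.
by apply: subset_trans tUX (subsetDl _ _).
Qed.

Lemma disj_mul_porbit_in x : x \in X -> porbit (c * t)%g x = porbit c x.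
Proof.
by apply: porbit_eq_in => y yX; rewrite ?disj_mul_in ?(perm_closed _ cX).
Qed.

Lemma disj_mul_porbit_out x : x \notin X -> porbit (c * t)%g x = porbit t x.
Proof.
move=> xX; apply: (@porbit_eq_in _ _ (~: X)) => [y|y|]; rewrite ?inE // => yX.
  have [yU|yU] := boolP (y \in U :\: X); last by rewrite (out_perm tUX).
  by have := perm_closed y tUX; rewrite yU inE => /andP[].
exact: disj_mul_out.
Qed.
End DisjointMul.

(** When [X] is an orbit of [s], this inverts the product of permutations with disjoint supports.
    The product of the two components is [s] for every [X]. *)
Definition peel X s : {perm T} * {perm T} :=
  (restr_perm X s, ((restr_perm X s)^-1 * s)%g).

Lemma porbits_closed X s x : X \in porbits s -> (s x \in X) = (x \in X).
Proof. by case/imsetP=> v _ ->; rewrite -!eq_porbit_mem (porbit_perm s 1). Qed.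

Lemma restr_perm_astabs X s x : (forall y, (s y \in X) = (y \in X)) ->
  x \in X -> restr_perm X s x = s x.
Proof. by move=> sX xX; apply: restr_permE => //; apply/astabsP => y /=; rewrite /aperm. Qed.

Lemma porbits_full_cycle X s : X \in porbits s -> full_cycle X (restr_perm X s).
Proof.
move=> Xs; have /imsetP[v _ XE] := Xs.
rewrite /full_cycle restr_perm_on; apply/forall_inP => x xX; apply/eqP.
have h := restr_perm_astabs (fun y => porbits_closed y Xs).
rewrite -(@porbit_eq_in s _ X) => [|y yX|y yX|//].
- by rewrite XE; apply/eqP; rewrite eq_porbit_mem -XE.
- by rewrite h // porbits_closed.
- by rewrite h.
Qed.

Lemma peel_mul U X c t : X \subset U -> full_cycle X c -> perm_on (U :\: X) t ->
  peel X (c * t)%g = (c, t).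
Proof.
move=> XU /andP[cX _] tU.
suff E : restr_perm X (c * t)%g = c by rewrite /peel E mulKg.
have clos y : ((c * t)%g y \in X) = (y \in X).
  have [yX|yX] := boolP (y \in X); first by rewrite (disj_mul_in cX tU) // (perm_closed _ cX).
  rewrite (disj_mul_out _ cX) //; apply/negbTE.
  have [yU|yU] := boolP (y \in U :\: X); last by rewrite (out_perm tU).
  by have := perm_closed y tU; rewrite yU inE => /andP[].
apply/permP => x; have [xX|xX] := boolP (x \in X).
  by rewrite restr_perm_astabs // (disj_mul_in cX tU).
by rewrite (out_perm cX xX) (out_perm (restr_perm_on _ _) xX).
Qed.

Lemma peel_perm_on U X s : perm_on U s -> X \in porbits s ->
  perm_on (U :\: X) (peel X s).2.
Proof.
move=> sU Xs; apply/subsetP => x; rewrite !inE /= permM => nx.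
have /andP[cX _] := porbits_full_cycle Xs.
have [xX|xX] /= := boolP (x \in X).
  case/negP: nx; apply/eqP; set y := ((restr_perm X s)^-1)%g x.
  have yX : y \in X by rewrite (perm_closed _ (perm_onV cX)).
  rewrite -(@restr_perm_astabs X s y) ?permKV //= => z; exact: porbits_closed.
have : s x != x by apply: contraNneq nx => sx; rewrite (out_perm (perm_onV cX)) ?sx.
by apply: contraR => xU; rewrite (out_perm sU).
Qed.

Lemma full_cycle_porbits_mul U X c t : X != set0 -> full_cycle X c ->
  perm_on (U :\: X) t -> X \in porbits (c * t)%g.
Proof.
move=> /set0Pn[v vX] /andP[cX /forall_inP cX'] tU; apply/imsetP; exists v => //.
by rewrite (disj_mul_porbit_in cX tU) // (eqP (cX' _ vX)).
Qed.

Lemma subset_porbits U X s : perm_on U s -> X \in porbits s -> (1 < #|X|)%N -> X \subset U.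
Proof.
move=> sU /imsetP[v _ ->] h; apply/subsetP => x xX; apply: contraTT h => xU.
move: xX; rewrite -eq_porbit_mem => /eqP <-.
by rewrite porbit_fix ?cards1 // (out_perm sU).
Qed.

End PermCycles.

Section PartialDet.
Variables (K : comNzRingType) (n : nat) (M : 'M[K]_n).
Implicit Types (s t c : {perm 'I_n}) (X Y U : {set 'I_n}) (k : nat).

Definition perm_term U s : K := (-1) ^+ s * \prod_(i in U) M i (s i).

(** For [k > n] this is the principal minor of [M] on [U]. Points outside [U] are fixed, so once
    [k > 1] they never violate shortness. *)
Definition short_det k U := \sum_(s | perm_on U s && short k s) perm_term U s.

Definition cycle_det X := \sum_(c | full_cycle X c) perm_term X c.

Lemma perm_term_mul U X c t : X \subset U -> perm_on X c -> perm_on (U :\: X) t ->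
  perm_term U (c * t)%g = perm_term X c * perm_term (U :\: X) t.
Proof.
move=> XU cX tU; rewrite /perm_term odd_permM signr_addb.
have -> : \prod_(i in U) M i ((c * t)%g i) =
   \prod_(i in X) M i (c i) * \prod_(i in U :\: X) M i (t i).
  rewrite (big_setID X) /=; congr (_ * _).
    rewrite (setIidPr XU); apply: eq_bigr => i iX; by rewrite (disj_mul_in cX tU).
  by apply: eq_bigr => i; rewrite inE => /andP[iX _]; rewrite (disj_mul_out _ cX).
by rewrite mulrACA.
Qed.

(** The product map is a bijection from pairs (full cycle on [X], short permutation of [U :\: X])
    onto the permutations on the left, with inverse [peel X], and [perm_term] is multiplicative
    along it. *)
Lemma short_split k U X : (1 < k)%N -> X \subset U -> X != set0 ->
  \sum_(s | [&& perm_on U s, X \in porbits s & [forall x, (x \notin X) ==> (#|porbit s x| < k)%N]])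
     perm_term U s = cycle_det X * short_det k (U :\: X).
Proof.
move=> k1 XU X0; rewrite /cycle_det /short_det big_distrlr pair_big /=.
pose h (p : {perm 'I_n} * {perm 'I_n}) := (p.1 * p.2)%g.
rewrite (reindex_onto h (peel X)); last by move=> s _; rewrite /h /peel /= mulKVg.
apply: eq_big => [[c t]|[c t]] /=.
  apply/andP/and3P => [[/and3P[sU Xs /forallP sh]] /eqP pE|[cX tU /forallP sh]].
    have := peel_perm_on sU Xs; rewrite pE /= => tU.
    have := porbits_full_cycle Xs; have -> : restr_perm X (h (c, t)) = c by rewrite -[LHS]/((peel X _).1) pE.
    move=> cX; split=> //; have [cX1 _] := andP cX.
    apply/forallP => x; have [xX|xX] := boolP (x \in X).
      by rewrite porbit_fix ?cards1 // (out_perm tU) // !inE xX.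
    by have := sh x; rewrite xX /= (disj_mul_porbit_out cX1 tU).
  have [cX1 _] := andP cX.
  rewrite /h /= (peel_mul XU cX tU) eqxx; split=> //; apply/and3P; split.
  - exact: disj_mul_perm_on XU cX1 tU.
  - exact: full_cycle_porbits_mul X0 cX tU.
  - by apply/forallP => x; apply/implyP => xX; rewrite (disj_mul_porbit_out cX1 tU).
case/andP => /and3P[sU Xs sh] /eqP pE.
have := peel_perm_on sU Xs; rewrite pE /= => tU.
have := porbits_full_cycle Xs; have -> : restr_perm X (h (c, t)) = c by rewrite -[LHS]/((peel X _).1) pE.
by case/andP => cX _; rewrite /h /= (perm_term_mul XU cX tU).
Qed.

(** Sort the permutations by the orbit [X] of [v] and split that orbit off. *)
Lemma short_det_expand k U v : (1 < k)%N -> v \in U ->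
  short_det k U = \sum_(X : {set 'I_n} | [&& X \subset U, v \in X & (#|X| < k)%N])
                     cycle_det X * short_det k (U :\: X).
Proof.
move=> k1 vU; rewrite {1}/short_det.
rewrite (partition_big (fun s => porbit s v) (fun X : {set 'I_n} => [&& X \subset U, v \in X & (#|X| < k)%N])) /=.
  apply: eq_bigr => X /and3P[XU vX Xk].
  rewrite -(short_split k1 XU); last by apply/set0Pn; exists v.
  apply: eq_bigl => s; rewrite -andbA; congr (_ && _).
  apply/andP/andP => [[/forallP sh /eqP XE]|[/imsetP[w _ XE] /forallP sh]].
    split; first by apply/imsetP; exists v.
    by apply/forallP => x; apply/implyP.
  have XE' : porbit s v = X by apply/eqP; rewrite XE eq_porbit_mem -XE.
  split; last by rewrite XE'.
  apply/forallP => x; have [xX|xX] := boolP (x \in X); last by have := sh x; rewrite xX.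
  by move: xX; rewrite -XE' -eq_porbit_mem => /eqP ->; rewrite XE'.
move=> s /andP[sU /forallP sh]; rewrite porbit_id sh !andbT.
have [h|h] := ltnP 1 #|porbit s v|; first exact: subset_porbits sU (imset_f _ _) h.
apply/subsetP => x; have /cards1P[y E] : #|porbit s v| == 1%N.
  by rewrite eqn_leq h lt0n card_porbit_neq0.
by have := porbit_id s v; rewrite E !inE => /eqP<- /eqP->.
Qed.

Lemma perm_onT s : perm_on setT s.
Proof. by apply/subsetP => x; rewrite inE. Qed.

(* As [n < 2 k], a permutation has at most one orbit of length at least [k]. *)
Lemma det_expand_long k : (1 < k)%N -> (n < k.*2)%N ->
  \det M = short_det k setT
    + \sum_(X : {set 'I_n} | (k <= #|X|)%N) cycle_det X * short_det k (setT :\: X).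
Proof.
move=> k1 n2k.
pose lng s := ~~ short k s.
have -> : \det M = \sum_s perm_term setT s.
  by apply: eq_bigr => s _; rewrite /perm_term; congr (_ * _); apply: eq_bigl => i; rewrite inE.
rewrite (bigID (short k)) /=; congr (_ + _).
  by apply: eq_bigl => s; rewrite perm_onT.
(* The default [set0] is never a value on permutations that are not short, and it has fewer than [k]
   elements, so it cannot be confused with a long orbit. *)
pose orb s : {set 'I_n} := odflt set0 [pick X in porbits s | (k <= #|X|)%N].
rewrite (partition_big orb (fun X => (k <= #|X|)%N)) /=; last first.
  move=> s; rewrite /short negb_forall => /existsP[x]; rewrite -leqNgt => xk.
  rewrite /orb; case: pickP => [X /andP[]//|/(_ (porbit s x))].
  by rewrite xk imset_f.
have uniqlong s X Y : X \in porbits s -> Y \in porbits s -> (k <= #|X|)%N -> (k <= #|Y|)%N -> X = Y.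
  move=> /imsetP[x _ ->] /imsetP[y _ ->] xk yk; apply/eqP; rewrite eq_porbit_mem.
  apply/negPn/negP => xy.
  have : [disjoint porbit s x & porbit s y].
    apply/pred0P => z /=; apply/negbTE/negP => /andP[].
    by rewrite -!eq_porbit_mem => /eqP -> ; rewrite eq_porbit_mem; apply/negP.
  rewrite -(leq_card_setU (porbit s x)) => /eqP E.
  have := max_card (porbit s x :|: porbit s y); rewrite E card_ord.
  by move: n2k xk yk; lia.
apply: eq_bigr => X Xk.
rewrite -(short_split k1 (subsetT _)); last by rewrite -card_gt0; apply: leq_trans Xk; apply: ltnW.
apply: eq_bigl => s; rewrite perm_onT /=.
apply/andP/andP => [[ns /eqP]|[Xs /forallP sh]].
  rewrite /orb; case: pickP => [Y /andP[Ys Yk]/= <-|_ /= X0]; last first.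
    by move: Xk; rewrite -X0 cards0; move: k1; lia.
  split=> //; apply/forallP => x; apply/implyP; apply: contraR; rewrite -leqNgt => xk.
  by rewrite (uniqlong _ _ _ Ys (imset_f (porbit s) (isT : x \in predT)) Yk xk) porbit_id.
split.
  rewrite /short negb_forall; have /imsetP[v _ XE] := Xs; apply/existsP; exists v.
  by rewrite -leqNgt -XE.
rewrite /orb; case: pickP => [Y /andP[Ys Yk]|/(_ X)]; last by rewrite Xs Xk.
by rewrite (uniqlong _ _ _ Ys Xs Yk Xk).
Qed.

End PartialDet.

Section CycleWeight.
Variables (K : comNzRingType) (n : nat) (B : 'M[K]_n) (z : K).
Implicit Types (c : {perm 'I_n}) (X U : {set 'I_n}) (k : nat).

(** Unsigned, unlike [cycle_det], hence nonnegative for nonnegative [B]: this is the coefficient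
    beta(X) of the expansion. *)
Definition cycle_weight X := \sum_(c | full_cycle X c) \prod_(i in X) B i (c i).

Let M := 1%:M - z *: B.

(** The identity matrix contributes only on singletons. On a longer cycle all entries are
    off-diagonal, and the factors [- z] together with the sign (-1)^(|X|-1) leave one minus sign. *)
Lemma cycle_det_weight X : X != set0 ->
  cycle_det M X = (#|X| == 1%N)%:R - z ^+ #|X| * cycle_weight X.
Proof.
move=> X0; have [/cards1P[v ->]|X1] := boolP (#|X| == 1%N).
  have E c : full_cycle [set v] c = (c == 1%g).
    apply/idP/eqP => [/andP[cv _]|->].
      apply/permP => x; rewrite perm1; have [xv|xv] := boolP (x \in [set v]); last exact: out_perm cv _.
      by have := perm_closed v cv; move: xv; rewrite !inE eqxx => /eqP -> /eqP.
    rewrite /full_cycle perm_on1; apply/forall_inP => x; rewrite inE => /eqP->.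
    by rewrite porbit_fix ?perm1.
  rewrite /cycle_det /cycle_weight (big_pred1 1%g) // (big_pred1 1%g) // cards1 expr1.
  by rewrite /perm_term !big_set1 odd_perm1 perm1 expr0 mul1r !mxE eqxx.
rewrite sub0r /cycle_det /cycle_weight mulr_sumr -sumrN; apply: eq_bigr => c cX.
have X2 : (1 < #|X|)%N by rewrite ltn_neqAle eq_sym X1 card_gt0.
rewrite /perm_term (full_cycle_odd X0 cX) signr_odd.
rewrite (eq_bigr (fun i => (- z) * B i (c i))) => [|i iX]; last first.
  by rewrite !mxE eq_sym (negbTE (full_cycle_moves cX X2 iX)) sub0r mulNr.
rewrite big_split /= prodr_const (exprNn z).
have -> : (-1) ^+ #|X| = - (-1) ^+ #|X|.-1 :> K by rewrite -{1}(prednK (ltnW X2)) exprS mulN1r.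
by rewrite !mulrA mulrN -expr2 sqrr_sign !mulNr mul1r.
Qed.

(** The diagonal 1 at [v] gives the term [short_det M k U]; all else that passes through [v] carries
    a minus sign. *)
Lemma short_det_step k U v : (1 < k)%N -> v \notin U ->
  short_det M k (v |: U) = short_det M k U
    - \sum_(X : {set 'I_n} | [&& X \subset v |: U, v \in X & (#|X| < k)%N])
         z ^+ #|X| * cycle_weight X * short_det M k ((v |: U) :\: X).
Proof.
move=> k1 vU; rewrite (short_det_expand _ k1 (setU11 v U)).
have E (X : {set 'I_n}) : v \in X -> cycle_det M X = (X == [set v])%:R - z ^+ #|X| * cycle_weight X.
  move=> vX; rewrite cycle_det_weight; last by apply/set0Pn; exists v.
  congr (_%:R - _); rewrite eq_sym -(cards1 v) eq_sym [in RHS]eq_sym eqEcard sub1set vX /=.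
  congr (nat_of_bool _); apply/eqP/idP => [->//|h]; apply/eqP; rewrite eqn_leq h.
  by apply: subset_leq_card; rewrite sub1set.
rewrite (eq_bigr (fun X : {set 'I_n} => (X == [set v])%:R * short_det M k ((v |: U) :\: X)
   - z ^+ #|X| * cycle_weight X * short_det M k ((v |: U) :\: X))); last first.
  by move=> X /and3P[_ vX _]; rewrite E // mulrBl.
rewrite sumrB; congr (_ - _).
rewrite (bigD1 [set v]) /=; last by rewrite sub1set setU11 set11 cards1.
rewrite eqxx mul1r big1 ?addr0; last by move=> X /andP[_ /negbTE->]; rewrite mul0r.
by congr short_det; rewrite setU1K.
Qed.

Lemma det_step k : (1 < k)%N -> (n < k.*2)%N ->
  \det M = short_det M k setT
    - \sum_(X : {set 'I_n} | (k <= #|X|)%N) z ^+ #|X| * cycle_weight X * short_det M k (setT :\: X).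
Proof.
move=> k1 n2k; rewrite (det_expand_long _ k1 n2k); congr (_ + _).
rewrite -sumrN; apply: eq_bigr => X Xk.
have X1 : (1 < #|X|)%N by apply: leq_trans Xk.
rewrite cycle_det_weight; last by rewrite -card_gt0; apply: ltnW.
by rewrite gtn_eqF // sub0r mulNr.
Qed.

Lemma short_det0 k : (1 < k)%N -> short_det M k set0 = 1.
Proof.
move=> k1; rewrite /short_det (big_pred1 1%g); first by rewrite /perm_term big_set0 odd_perm1 mulr1.
move=> s; apply/andP/eqP => [[s0 _]|->].
  by apply/permP => x; rewrite perm1 (out_perm s0) // inE.
by rewrite perm_on1; split=> //; apply/forallP => x; rewrite porbit_fix ?perm1 ?cards1.
Qed.
End CycleWeight.

Lemma cycle_weight_map (K L : comNzRingType) (f : {rmorphism K -> L}) n (B : 'M[K]_n) X :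
  cycle_weight (map_mx f B) X = f (cycle_weight B X).
Proof.
rewrite /cycle_weight rmorph_sum; apply: eq_bigr => c _; rewrite rmorph_prod.
by apply: eq_bigr => i _; rewrite mxE.
Qed.

Lemma cycle_weight_ge0 (K : realDomainType) n (B : 'M[K]_n) X :
  (forall i j, 0 <= B i j) -> 0 <= cycle_weight B X.
Proof. by move=> B0; apply: sumr_ge0 => c _; apply: prodr_ge0. Qed.

(** * Row-sum bounds and positivity of principal minors *)

Lemma eigenvalue_norm_le (K : numFieldType) n (M : 'M[K]_n) (t a : K) :
  (forall i, \sum_j `|M i j| <= t) -> eigenvalue M a -> `|a| <= t.
Proof.
move=> Mt /eigenvalueP[u uM u0].
(* Eigenvectors are row vectors, so the estimate is made in the l1 norm of [u], for which row sums
   control the action of [M]. *)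
have S0 : 0 < \sum_j `|u 0 j|.
  rewrite lt_def sumr_ge0 // andbT; apply: contraNneq u0 => /eqP.
  rewrite psumr_eq0 // => /allP h; apply/eqP/rowP => j; rewrite mxE.
  by have := h j (mem_index_enum j); rewrite /= normr_eq0 => /eqP.
rewrite -(ler_pM2r S0) mulr_sumr.
have -> : \sum_j `|a| * `|u 0 j| = \sum_j `|\sum_i u 0 i * M i j|.
  apply: eq_bigr => j _; rewrite -normrM; congr `|_|.
  by move/rowP/(_ j): uM; rewrite !mxE.
apply: (@le_trans _ _ (\sum_j \sum_i `|u 0 i| * `|M i j|)).
  apply: ler_sum => j _; apply: le_trans (ler_norm_sum _ _ _) _.
  by apply: ler_sum => i _; rewrite normrM.
rewrite exchange_big mulr_sumr; apply: ler_sum => i _ /=.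
by rewrite -mulr_sumr [leRHS]mulrC ler_wpM2l.
Qed.

(** For x in [0, 1] the matrix xB cannot have eigenvalue 1, so the polynomial det(1 - xB) has no
    zero there; it equals 1 at x = 0. *)
Lemma det1B_gt0 (K : rcfType) n (B : 'M[K]_n) (t : K) : t < 1 ->
  (forall i, \sum_j `|B i j| <= t) -> 0 < \det (1%:M - B).
Proof.
move=> t1 Bt; case: (posnP n) => [n0|n_gt0].
  by move: B Bt; rewrite n0 => B Bt; rewrite det_mx00 ltr01.
have t0 : 0 <= t by apply: le_trans (Bt (Ordinal n_gt0)); apply: sumr_ge0.
pose P := \det (1%:M - 'X *: map_mx polyC B).
have PE x : P.[x] = \det (1%:M - x *: B).
  rewrite -horner_evalE -det_map_mx; congr (\det _); apply/matrixP => i j.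
  rewrite !mxE /= !horner_evalE hornerD hornerN hornerM hornerX hornerC.
  by rewrite -[in LHS](polyC_natr _ (i == j)) hornerC. 
have Pn0 x : 0 <= x <= 1 -> P.[x] != 0.
  move=> /andP[x0 x1]; rewrite PE; apply/negP => /det0P[u u0 uB].
  have : eigenvalue (x *: B) 1.
    apply/eigenvalueP; exists u => //; rewrite scale1r.
    by move/eqP: uB; rewrite mulmxBr mulmx1 subr_eq0 => /eqP <-.
  move/(@eigenvalue_norm_le _ _ _ t); rewrite normr1 => h.
  have /h : forall i, \sum_j `|(x *: B) i j| <= t; last by rewrite leNgt t1.
  move=> i; apply: le_trans (Bt i); apply: ler_sum => j _; rewrite mxE normrM (ger0_norm x0).
  by rewrite ler_piMl.
rewrite -[B]scale1r -PE lt_def Pn0 ?lexx ?ler01 //= leNgt; apply/negP => P1.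
have P0 : P.[0] = 1 by rewrite PE scale0r subr0 det1.
have [|x] := @poly_ivt _ (- P) 0 1 ler01; first by rewrite !hornerN P0; lra.
by move=> x01; rewrite rootN rootE (negbTE (Pn0 _ x01)).
Qed.

(** With bound [n.+1] every permutation is short, so this is a principal minor. Clearing the rows
    outside [U] makes it a full determinant with the same row-sum bound. *)
Lemma short_det_all_gt0 (K : rcfType) n (B : 'M[K]_n) (t : K) (U : {set 'I_n}) : 0 <= t < 1 ->
  (forall i, \sum_j `|B i j| <= t) -> 0 < short_det (1%:M - 1 *: B) n.+1 U.
Proof.
move=> /andP[t0 t1] Bt; pose B' := \matrix_(i, j) if i \in U then B i j else 0.
have B't i : \sum_j `|B' i j| <= t.
  have [iU|iU] := boolP (i \in U); last first.
    by rewrite big1 // => j _; rewrite mxE (negbTE iU) normr0.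
  by apply: le_trans (Bt i); apply: ler_sum => j _; rewrite mxE iU.
have := det1B_gt0 t1 B't; congr (0 < _).
rewrite /determinant (bigID (perm_on U)) /= [X in _ + X]big1 ?addr0; last first.
  move=> s /subsetPn[x sx xU]; rewrite (bigD1 x) //= !mxE (negbTE xU) subr0 eq_sym.
  by rewrite inE in sx; rewrite (negbTE sx) mul0r mulr0.
apply: eq_big => [s|s sU].
  apply/idP/andP => [sU|[]//]; split=> //; apply/forallP => x; rewrite ltnS.
  by rewrite -[X in (_ <= X)%N]card_ord; apply: max_card.
congr (_ * _); rewrite (bigID (mem U)) /= [X in _ * X]big1 ?mulr1.
  by apply: eq_bigr => i iU; rewrite !mxE iU mul1r.
by move=> i iU; rewrite !mxE (negbTE iU) (out_perm sU iU) eqxx subr0.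
Qed.

(** Induction on cardinality for ratios: [P U] stands for positivity or nonvanishing at [U], and
    [Q U' U] for a bound on the ratio of the values at [U'] and [U]. Transitivity of [Q] chains the
    one-point steps. *)
Lemma set_ratio_ind (T : finType) (P : {set T} -> Prop) (Q : {set T} -> {set T} -> Prop) :
  P set0 -> (forall U, P U -> Q U U) ->
  (forall U1 U2 U3, P U1 -> P U2 -> P U3 -> Q U1 U2 -> Q U2 U3 -> Q U1 U3) ->
  (forall (U : {set T}) v, v \notin U -> (forall U' : {set T}, U' \subset U -> P U' /\ Q U' U) ->
     P (v |: U) /\ Q U (v |: U)) ->
  forall U U' : {set T}, U' \subset U -> P U' /\ Q U' U.
Proof.
move=> P0 Qr Qt st U; have [m] := ubnP #|U|; elim: m U => // m IH V Vm.
have stV v : v \in V -> (forall U' : {set T}, U' \subset V :\ v -> P U' /\ Q U' (V :\ v)) /\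
    (P V /\ Q (V :\ v) V).
  move=> vV; have IHv : forall U' : {set T}, U' \subset V :\ v -> P U' /\ Q U' (V :\ v).
    by apply: IH; move: Vm; rewrite (cardsD1 v) vV add1n ltnS.
  by split=> //; rewrite -[V in P V](setD1K vV) -[V in Q _ V](setD1K vV); apply: st => //; rewrite setD11.
have PV : P V.
  have [->//|[v /stV[_ []//]]] := set_0Vmem V.
move=> U' U'V; have [->|U'nV] := eqVneq U' V; first by split=> //; apply: Qr.
have /properP[_ [v vV vU']] : U' \proper V by rewrite properEneq U'nV.
have [IHv [_ QV]] := stV v vV.
have U'D : U' \subset V :\ v by rewrite subsetD1 U'V.
have [PU' QU'] := IHv _ U'D; have [PD _] := IHv _ (subxx _).
by split=> //; apply: Qt QV.
Qed.

(** * Ratio comparison for solutions of the cycle recursion *)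

Section CycleRecursion.
Variables (R : realFieldType) (n : nat) (beta : {set 'I_n} -> R).
Implicit Types (U X : {set 'I_n}).
Hypothesis beta_ge0 : forall X, 0 <= beta X.

(** The embedding [io] and the point [z] let one definition cover both the real values at 1 and the
    complex values. *)
Definition cycle_recursion (C : nzRingType) (io : R -> C) (z : C) (k : nat)
    (F : {set 'I_n} -> C) : Prop :=
  F set0 = 1 /\ forall U v, v \notin U ->
    F (v |: U) = F U - \sum_(X : {set 'I_n} | [&& X \subset v |: U, v \in X & (#|X| < k)%N])
                   z ^+ #|X| * io (beta X) * F ((v |: U) :\: X).

Lemma subset_setU1D U v X : v \in X -> (v |: U) :\: X \subset U.
Proof.
move=> vX; apply/subsetP => x; rewrite !inE => /andP[xX /orP[/eqP xv|//]].
by rewrite xv vX in xX.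
Qed.

(** [D] keeps all cycles, [f] only those shorter than [k]. With fewer terms subtracted, and smaller
    ratios in them by induction, adding a point multiplies [f] by at least the positive factor by
    which it multiplies [D]. *)
Lemma cycle_recursion_gt0 (k : nat) (f D : {set 'I_n} -> R) :
  cycle_recursion id 1 k f -> cycle_recursion id 1 n.+1 D ->
  (forall U, 0 < D U) -> forall U, 0 < f U.
Proof.
move=> [f0 fS] [D0 DS] Dgt0 U.
apply: (proj1 (@set_ratio_ind _ (fun U => 0 < f U) (fun U' U => f U' / f U <= D U' / D U) _ _ _ _ U U (subxx _))).
- by rewrite f0.
- by move=> V fV; rewrite !divff ?gt_eqF.
- move=> U1 U2 U3 f1 f2 f3 h1 h2.
  have := ler_pM (divr_ge0 (ltW f1) (ltW f2)) (divr_ge0 (ltW f2) (ltW f3)) h1 h2.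
  by rewrite !mulrA !divfK ?gt_eqF.
move=> {}U v vU H; have [fU _] := H U (subxx _).
pose V := v |: U.
have key : D V / D U <= f V / f U.
  rewrite /V fS // DS // !mulrBl !divff ?gt_eqF // lerD2l lerN2 !mulr_suml.
  rewrite big_mkcond [leRHS]big_mkcond /=; apply: ler_sum => X _.
  case: ifP => [/and3P[XV vX _]|_].
    rewrite XV vX ltnS /= (leq_trans (max_card _)) ?card_ord //.
    rewrite !expr1n !mul1r -!mulrA ler_wpM2l //.
    by have [] := H _ (subset_setU1D U vX).
  case: ifP => // _; rewrite expr1n mul1r; apply: divr_ge0; last exact: ltW.
  by apply: mulr_ge0 => //; apply: ltW.
have fV : 0 < f V.
  by rewrite -(pmulr_lgt0 _ (_ : 0 < (f U)^-1)) ?invr_gt0 //; apply: lt_le_trans key; apply: divr_gt0.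
split=> //; rewrite -[f U / f V]invf_div -[D U / D V]invf_div lef_pV2 ?posrE ?divr_gt0 //.
Qed.

(** Dividing the recursion for V = [v |: U] by [F U] gives F(V)/F(U) = 1 - sum of g(X) z^|X| w(X),
    where w(X) lies in [W] by induction and the weights g(X) are nonnegative with sum 1 - f(V)/f(U)
    < 1. The third hypothesis on [W] then treats one added point, and closure under products treats
    chains. *)
Lemma cycle_recursion_ratio (C : fieldType) (io : {rmorphism R -> C}) (z : C) (W : C -> Prop)
    (k : nat) (f : {set 'I_n} -> R) (F : {set 'I_n} -> C) :
  W 1 -> (forall w1 w2, W w1 -> W w2 -> W (w1 * w2)) ->
  (forall (I : finType) (P : pred I) (g : I -> R) (b : I -> nat) (w : I -> C),
     (forall i, P i -> [/\ 0 <= g i, (0 < b i < k)%N & W (w i)]) ->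
     \sum_(i | P i) g i < 1 ->
     1 - \sum_(i | P i) io (g i) * (z ^+ b i * w i) != 0 /\
     W (io (1 - \sum_(i | P i) g i) / (1 - \sum_(i | P i) io (g i) * (z ^+ b i * w i)))) ->
  cycle_recursion id 1 k f -> cycle_recursion io z k F -> (forall U, 0 < f U) ->
  forall U U', U' \subset U ->
    F U' != 0 /\ W ((F U' / F U) * (io (f U) / io (f U'))).
Proof.
move=> W1 WM WD [f0 fS] [F0 FS] fgt0.
have f0' U : io (f U) != 0 by rewrite fmorph_eq0 gt_eqF.
apply: set_ratio_ind.
- by rewrite F0 oner_eq0.
- by move=> U FU; rewrite !divff // mulr1.
- move=> U1 U2 U3 F1 F2 F3 w12 w23.
  have := WM _ _ w12 w23; congr W.
  by field; rewrite F2 F3 !f0'.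
move=> U v vU H; have [FU _] := H U (subxx _).
pose V := v |: U.
pose P (X : {set 'I_n}) := [&& X \subset V, v \in X & (#|X| < k)%N].
pose g X := beta X * f (V :\: X) / f U.
pose w X := (F (V :\: X) / F U) * (io (f U) / io (f (V :\: X))).
have sg : \sum_(X | P X) g X = 1 - f V / f U.
  rewrite /V fS // mulrBl divff ?gt_eqF // opprB addrC subrK mulr_suml.
  by apply: eq_bigr => X _; rewrite expr1n mul1r.
have sF : 1 - \sum_(X | P X) io (g X) * (z ^+ #|X| * w X) = F V / F U.
  rewrite /V FS // mulrBl divff //; congr (_ - _); rewrite mulr_suml.
  apply: eq_bigr => X _; rewrite /g /w !rmorphM fmorphV; field.
  by rewrite FU !f0'.
have [] := WD _ P g (fun X => #|X|) w.
- move=> X /and3P[XV vX Xk]; split.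
  + by rewrite !mulr_ge0 ?invr_ge0 // ltW.
  + by rewrite Xk andbT card_gt0; apply/set0Pn; exists v.
  + by have [_] := H _ (subset_setU1D U vX).
- by rewrite sg; have := divr_gt0 (fgt0 V) (fgt0 U); lra.
rewrite sF sg => FVU; rewrite opprB addrC subrK => WV.
have FV : F V != 0 by apply: contraNneq FVU => ->; rewrite mul0r.
split=> //; move: WV; congr W; rewrite fmorph_div -/V; field.
by rewrite FU FV !f0'.
Qed.
End CycleRecursion.

(** * The wedge *)

Section CosExp.
Local Open Scope classical_set_scope.
Local Open Scope ring_scope.
Variable R : realType.
Implicit Types (p t x y : R).

(** The function e^(pt) (cos t - p sin t) is 1 at t = 0 and has derivative -(1 + p^2) e^(pt) sin t,
    nonpositive on [0, pi]. *)
Lemma cosBsin_le_expR_ge0 p t : 0 <= t <= pi -> cos t - p * sin t <= expR (- (p * t)).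
Proof.
move=> /andP[t0 tpi].
pose h : R -> R := (expR \o (p \*: (id : R -> R))) * (cos - (p \*: (sin : R -> R))) .
have hE x : h x = expR (p * x) * (cos x - p * sin x) by [].
have hd x : is_derive x 1 h (- ((1 + p ^+ 2) * expR (p * x) * sin x)).
  apply: is_derive_eq.
  rewrite -[LHS]/(expR (p * x) * (- sin x - p * cos x) + (cos x - p * sin x) * (expR (p * x) * (p * 1))).
  ring.
have hc : {within `[0, t], continuous h}.
  apply: continuous_subspaceT => x; apply: differentiable_continuous.
  by apply/derivable1_diffP; apply: ex_derive.
have [c /[!in_itv]/= /andP[c0 ct]] := MVT_segment t0 (fun x _ => hd x) hc.
have sc : 0 <= sin c by apply: sin_ge0_pi; rewrite c0 (le_trans ct).
rewrite subr0 => hh.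
have : h t <= 1.
  have -> : 1 = h 0 by rewrite hE mulr0 expR0 cos0 sin0; ring.
  rewrite -subr_le0 hh mulNr oppr_le0 !mulr_ge0 ?expR_ge0 ?addr_ge0 ?sqr_ge0 //.
by rewrite hE expRN -ler_pdivlMl ?expR_gt0 // mulr1.
Qed.

Lemma cosBsin_le_expR p t : `|t| <= pi -> cos t - p * sin t <= expR (- (p * t)).
Proof.
have [t0|t0] := ger0P t => tpi; first by apply: cosBsin_le_expR_ge0; rewrite t0.
have := @cosBsin_le_expR_ge0 (- p) (- t); rewrite cosN sinN !mulrNN; apply.
by rewrite tpi oppr_ge0 ltW.
Qed.

(** Below -pi the left side is at most 1 + p, hence at most 1 - pt, which the exponential
    dominates. *)
Lemma cosBsin_le_expR_half p t : 0 <= p -> t <= pi -> cos t - p * sin t <= expR (- (p * t)).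
Proof.
move=> p0 tpi; have [h|h] := leP (- pi) t.
  by apply: cosBsin_le_expR; rewrite ler_norml h.
apply: le_trans (expR_ge1Dx _).
have := cos_le1 t; have := sin_geN1 t; have := @pi_ge2 R.
by nra.
Qed.
End CosExp.

Section Polar.
Variable R : realType.
Implicit Types (p x y : R).
Local Notation C := R[i].

(** This is exp(x + iy). *)
Definition polar x y : C := ((expR x * cos y) +i* (expR x * sin y))%C.

Lemma eqc (a b c d : R) : a = c -> b = d -> (a +i* b)%C = (c +i* d)%C.
Proof. by move=> -> ->. Qed.

Lemma mulcE (a b c d : R) : (a +i* b)%C * (c +i* d)%C = ((a * c - b * d) +i* (a * d + b * c))%C.
Proof. by []. Qed.

Lemma polar0 : polar 0 0 = 1.
Proof. by rewrite /polar expR0 cos0 sin0 mulr1 mulr0. Qed.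

Lemma polarD x y x' y' : polar (x + x') (y + y') = polar x y * polar x' y'.
Proof. by rewrite /polar mulcE expRD cosD sinD; apply: eqc; ring. Qed.

Lemma polarX x y m : polar x y ^+ m = polar (m%:R * x) (m%:R * y).
Proof.
elim: m => [|m IH]; first by rewrite expr0 !mul0r polar0.
by rewrite exprS IH -polarD; congr polar; rewrite -natr1; ring.
Qed.

Lemma polar_neq0 x y : polar x y != 0.
Proof.
apply/eqP => h; have := polarD x y (- x) (- y).
by rewrite !subrr polar0 h mul0r => /eqP; rewrite oner_eq0.
Qed.

Lemma polarV x y : (polar x y)^-1 = polar (- x) (- y).
Proof.
apply: (mulfI (polar_neq0 x y)); rewrite divff ?polar_neq0 //.
by rewrite -polarD !subrr polar0.
Qed.

Lemma ReM_polar p x y :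
  complex.Re ((1 +i* p)%C * polar x y) = expR x * (cos y - p * sin y).
Proof. by rewrite /=; ring. Qed.

Lemma ReD (u v : C) : complex.Re (u + v) = complex.Re u + complex.Re v.
Proof. by case: u v => [? ?] []. Qed.

Lemma ReN (u : C) : complex.Re (- u) = - complex.Re u.
Proof. by case: u. Qed.

Lemma ReZ (a : R) (u : C) : complex.Re (a%:C%C * u) = a * complex.Re u.
Proof. by case: u => [? ?] /=; ring. Qed.

Lemma Re_sum I (r : seq I) (P : pred I) (F : I -> C) :
  complex.Re (\sum_(i <- r | P i) F i) = \sum_(i <- r | P i) complex.Re (F i).
Proof. by apply: (big_morph _ ReD). Qed.

(** The image under exp of a convex cone of pairs (x, y). The angle [y] is not reduced modulo 2 pi,
    so closure under products is closure of the cone under addition. *)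
Definition wedge (a b : R) (w : C) : Prop :=
  exists x y, [/\ w = polar x y, x <= b * y & x <= - (a * y)].

Lemma wedge1 a b : wedge a b 1.
Proof. by exists 0, 0; rewrite polar0 !mulr0 oppr0. Qed.

Lemma wedgeM a b w1 w2 : wedge a b w1 -> wedge a b w2 -> wedge a b (w1 * w2).
Proof.
move=> [x1 [y1 [-> h1 h2]]] [x2 [y2 [-> h3 h4]]]; exists (x1 + x2), (y1 + y2).
by rewrite polarD; split=> //; lra.
Qed.

(** For d = u + iv the last two hypotheses say that (1 + bi)d and (1 - ai)d have nonnegative real
    part. Writing 1 + d = exp(x + if) with |f| < pi/2, the bound cos f - p sin f <= e^(-pf) at p = b
    and p = -a turns them into the linear conditions on (x, f) that define the wedge. *)
Lemma wedge_inv a b (u v : R) : 0 < a -> 0 < b -> 0 <= u - b * v -> 0 <= u + a * v ->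
  1 + (u +i* v)%C != 0 /\ wedge a b (1 / (1 + (u +i* v)%C)).
Proof.
move=> a0 b0 h1 h2.
have u0 : 0 <= u by have [v0|v0] := leP 0 v; nra.
pose U := 1 + u; have U1 : 1 <= U by rewrite lerDl.
have U0 : 0 < U by apply: lt_le_trans U1.
pose f := atan (v / U).
have cf : 0 < cos f by apply: cos_gt0_pihalf; rewrite atan_gtNpi2 atan_ltpi2.
have sf : sin f = v / U * cos f by rewrite -[v / U]atanK /tan divfK ?gt_eqF.
pose r := U / cos f; have r0 : 0 < r by apply: divr_gt0.
have [x xr] : exists x, expR x = r by exists (ln r); rewrite lnK.
have E : 1 + (u +i* v)%C = polar x f.
  rewrite /polar xr sf /r -[1]/(1 +i* 0)%C; apply: eqc; first by rewrite divfK ?gt_eqF.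
  by rewrite add0r; field; rewrite !gt_eqF.
have fpi : `|f| <= pi.
  have := atan_gtNpi2 (v / U); have := atan_ltpi2 (v / U); have := @pi_gt0 R.
  by rewrite -/f ler_norml => *; apply/andP; split; lra.
have key p : 0 <= u - p * v -> p * f <= x.
  move=> h; rewrite -ler_expR -[leLHS]invrK -expRN xr.
  have := cosBsin_le_expR p fpi; rewrite -(ler_pM2l r0) => h'.
  rewrite -div1r ler_pdivrMr ?expR_gt0 //; apply: le_trans h'.
  rewrite sf /r.
  have -> : U / cos f * (cos f - p * (v / U * cos f)) = 1 + (u - p * v).
    by rewrite /U; field; rewrite -/U !gt_eqF.
  by rewrite lerDl.
rewrite E polar_neq0; split=> //; exists (- x), (- f); rewrite div1r polarV; split=> //.
  by have := key _ h1; lra.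
by have := key (- a); rewrite !mulNr opprK => /(_ h2); lra.
Qed.

End Polar.

(** Take [i] congruent to m/q modulo [s]; the bounds on [m] then confine [j]. This expresses z^m
    through z^q and z^s. *)
Lemma coprime_window q s m : (0 < q)%N -> (q < s)%N -> coprime q s ->
  (q <= m)%N -> (m < q + s)%N ->
  exists i j : nat, [/\ (m + j * s = i * q)%N, (0 < i <= s)%N & (j < q)%N].
Proof.
move=> q0 qs cop qm ms; have s0 : (0 < s)%N by apply: leq_trans qs.
have [i /andP[i0 his] E] : exists2 i, (0 < i <= s)%N & (i * q = m %[mod s])%N.
  have [u v uv _] := egcdnP s q0; rewrite (eqP cop) in uv.
  have key : (u * m %% s * q = m %[mod s])%N.
    by rewrite modnMml mulnAC uv mulnDl mul1n mulnAC modnMDl.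
  have [h|h] := posnP (u * m %% s)%N.
    (* A zero residue is replaced by [s], since [i] must be positive. *)
    exists s; first by rewrite s0 leqnn.
    by rewrite modnMr -key h mul0n mod0n.
  by exists (u * m %% s)%N; rewrite // h ltnW // ltn_pmod.
have mi : (m <= i * q)%N.
  rewrite leqNgt; apply/negP => him.
  have : (s %| m - i * q)%N by rewrite -(eqn_mod_dvd _ (ltnW him)) eq_sym; apply/eqP.
  move=> /dvdnP[k kE]; have : (q <= i * q)%N by rewrite leq_pmull.
  by case: k kE => [|k] kE; move: him ms; nia.
have : (s %| i * q - m)%N by rewrite -(eqn_mod_dvd _ mi); apply/eqP.
move=> /dvdnP[j jE]; exists i, j; split; [lia|by rewrite i0|].
rewrite ltnNge; apply/negP => qj; have : (q * s <= j * s)%N by rewrite leq_mul2r qj orbT.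
have : (i * q <= s * q)%N by rewrite leq_mul2r his orbT.
by move: jE; nia.
Qed.

(** * The separating functional [nu] and stability of the wedge *)

Section Separation.
Variable R : realType.
Variables (q s : nat) (l A B a b : R) (nu z : R[i]).
Hypotheses (l0 : 0 <= l) (A0 : 0 < A) (B0 : 0 < B) (AB : A + B < pi)
  (qsAB : q%:R * B + s%:R * A = pi *+ 2).
Hypotheses (q0 : (0 < q)%N) (qs : (q < s)%N) (cop : coprime q s).
Hypotheses (zq : z ^+ q = polar (q%:R * l) (- A)) (zs : z ^+ s = polar (s%:R * l) B).
(* That is, [nu * z ^+ q = 1 - a i] and [nu * z ^+ s = 1 + b i]. *)
Hypotheses (nuA : nu = (1 +i* (- a))%C * polar (- (q%:R * l)) A)
  (nuB : nu = (1 +i* b)%C * polar (- (s%:R * l)) (- B)) (nu1 : 1 < complex.Re nu).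

(** Re nu = e^(-ql) (cos A + a sin A) exceeds 1 and is at most e^(aA - ql). *)
Let qlA : q%:R * l < a * A.
Proof.
have Api : `|- A| <= pi by rewrite normrN gtr0_norm //; move: A0 B0 AB; lra.
have := cosBsin_le_expR a Api; rewrite cosN sinN !mulrN !opprK => h.
have := nu1; rewrite nuA ReM_polar mulNr opprK expRN => h1.
rewrite -ltr_expR; apply: lt_le_trans h.
by rewrite -[ltLHS]mulr1 -ltr_pdivlMl ?expR_gt0.
Qed.

Let slB : s%:R * l < b * B.
Proof.
have Bpi : `|- B| <= pi by rewrite normrN gtr0_norm //; move: A0 B0 AB; lra.
have := cosBsin_le_expR b Bpi; rewrite cosN sinN !mulrN !opprK => h.
have := nu1; rewrite nuB ReM_polar cosN sinN mulrN opprK expRN => h1.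
rewrite -ltr_expR; apply: lt_le_trans h.
by rewrite -[ltLHS]mulr1 -ltr_pdivlMl ?expR_gt0.
Qed.

Let a0 : 0 < a.
Proof. by rewrite -(pmulr_lgt0 _ A0); apply: le_lt_trans qlA; rewrite mulr_ge0. Qed.

Let b0 : 0 < b.
Proof. by rewrite -(pmulr_lgt0 _ B0); apply: le_lt_trans slB; rewrite mulr_ge0. Qed.

(** With m = iq - js, the angle of nu z^m w measured from 1 - ai is -(d - y), and from 1 + bi it is
    d' + y up to a full turn. As d + d' = 2 pi - (A + B), one of d - y and d' + y is at most pi,
    where cos - p sin is bounded by an exponential; the resulting exponent is nonpositive. *)
Lemma Re_nu_pow_le1 m w : (q <= m)%N -> (m < q + s)%N -> wedge a b w ->
  complex.Re (nu * (z ^+ m * w)) <= 1.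
Proof.
move=> qm ms [x [y [-> xb xa]]].
have [i [j [mE /andP[i0 his] jq]]] := coprime_window q0 qs cop qm ms.
have mR : m%:R = i%:R * q%:R - j%:R * s%:R :> R.
  by rewrite -!natrM -mE natrD addrK.
have zm : z ^+ m = polar (m%:R * l) (- (i%:R * A) - j%:R * B).
  apply: (mulIf (expf_neq0 j (polar_neq0 (s%:R * l) B))).
  rewrite -{1}zs -exprM -exprD mulnC mE mulnC exprM zq !polarX -polarD mR.
  by congr polar; ring.
have hi : (i - 1)%:R = i%:R - 1 :> R by rewrite natrB.
have hs : (s - i)%:R = s%:R - i%:R :> R by rewrite natrB.
have hq : (q - j.+1)%:R = q%:R - j%:R - 1 :> R by rewrite natrB // -natr1; ring.
pose d := (i - 1)%:R * A + j%:R * B.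
pose d' := (s - i)%:R * A + (q - j.+1)%:R * B.
have dd' : d + d' = pi *+ 2 - (A + B) by rewrite -qsAB /d /d' hi hs hq; ring.
(* Here (m - q)l = (i - 1)ql - jsl is at most (i - 1)aA, because ql < aA and l is nonnegative. *)
have md : m%:R * l <= q%:R * l + a * d.
  have h1 : (i - 1)%:R * (q%:R * l) <= (i - 1)%:R * (a * A) by rewrite ler_wpM2l // ltW.
  have h2 : 0 <= j%:R * (s%:R * l) by rewrite !mulr_ge0.
  have h3 : 0 <= j%:R * (a * B) by rewrite !mulr_ge0 // ltW.
  by rewrite mR /d; move: h1; rewrite hi; lra.
have md' : m%:R * l <= s%:R * l + b * d'.
  have h1 : (q - j.+1)%:R * (s%:R * l) <= (q - j.+1)%:R * (b * B) by rewrite ler_wpM2l // ltW.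
  have h2 : 0 <= (s - i)%:R * (q%:R * l) by rewrite !mulr_ge0.
  have h3 : 0 <= (s - i)%:R * (b * A) by rewrite !mulr_ge0 // ltW.
  by rewrite mR /d'; move: h1 h2 h3; rewrite hs hq; lra.
have [h|h] := leP (d - y) pi.
  rewrite nuA zm -mulrA -!polarD ReM_polar.
  set X := _ + _; set Y := _ + (_ + _).
  have -> : Y = - (d - y) by rewrite /Y /d hi; ring.
  rewrite cosN sinN mulrNN.
  apply: (@le_trans _ _ (expR X * expR (- (a * (d - y))))).
    by rewrite ler_wpM2l ?expR_ge0 // cosBsin_le_expR_half // ltW.
  by rewrite -expRD expR_le1 /X; lra.
have h' : d' + y <= pi by move: A0 B0; lra.
rewrite nuB zm -mulrA -!polarD ReM_polar.
set X := _ + _; set Y := _ + (_ + _).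
have -> : Y = d' + y - pi *+ 2 by rewrite -qsAB /Y /d' hs hq; ring.
rewrite -(cosD2pi (_ - _)) -(sinD2pi (_ - _)) subrK.
apply: (@le_trans _ _ (expR X * expR (- (b * (d' + y))))).
  by rewrite ler_wpM2l ?expR_ge0 // cosBsin_le_expR_half // ltW.
by rewrite -expRD expR_le1 /X; lra.
Qed.

(** With r the total weight and S the complex sum, 1 - S = (1 - r)(1 + d). When nu z^m = 1 + ci, the
    product (1 + ci)(r - S) is the sum of the g_i ((1 + ci) - nu z^(m + k_i) w_i), whose real part
    is nonnegative as m + k_i stays in [q, q + s). The cases m = s and m = q supply the two
    conditions of [wedge_inv]. *)
Lemma wedge_resolvent (I : finType) (P : pred I) (g : I -> R) (k : I -> nat) (w : I -> R[i]) :
  (forall i, P i -> [/\ 0 <= g i, (0 < k i < q)%N & wedge a b (w i)]) ->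
  \sum_(i | P i) g i < 1 ->
  1 - \sum_(i | P i) real_complex R (g i) * (z ^+ k i * w i) != 0 /\
  wedge a b (real_complex R (1 - \sum_(i | P i) g i) /
             (1 - \sum_(i | P i) real_complex R (g i) * (z ^+ k i * w i))).
Proof.
move=> H r1; set r := \sum_(i | P i) g i; set S := \sum_(i | P i) _.
have r0 : 0 < 1 - r by rewrite subr_gt0.
have rC : real_complex R (1 - r) != 0 by rewrite fmorph_eq0 gt_eqF.
pose d := (real_complex R r - S) / real_complex R (1 - r).
have E : 1 - S = real_complex R (1 - r) * (1 + d).
  by rewrite mulrDr mulr1 mulrC divfK // rmorphB rmorph1; ring.
have cond c m : nu * z ^+ m = (1 +i* c)%C -> (q <= m)%N -> (m <= s)%N ->
    0 <= complex.Re ((1 +i* c)%C * d).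
  move=> nuc qm ms.
  have -> : (1 +i* c)%C * d = real_complex R (1 - r)^-1 * ((1 +i* c)%C * (real_complex R r - S)).
    by rewrite /d fmorphV mulrA [RHS]mulrC.
  rewrite ReZ mulr_ge0 //; first by rewrite invr_ge0 ltW.
  rewrite /r /S rmorph_sum -sumrB mulr_sumr Re_sum; apply: sumr_ge0 => i Pi.
  have [g0 /andP[k0 kq] wi] := H i Pi.
  have -> : (1 +i* c)%C * (real_complex R (g i) - real_complex R (g i) * (z ^+ k i * w i)) =
     real_complex R (g i) * ((1 +i* c)%C - nu * (z ^+ (m + k i) * w i)).
    by rewrite -nuc exprD; ring.
  rewrite ReZ mulr_ge0 // ReD ReN subr_ge0; apply: Re_nu_pow_le1 => //.
    exact: leq_trans qm (leq_addr _ _).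
  by rewrite addnC -addSn leq_add.
have [u [v dE]] : exists u v, d = (u +i* v)%C by case: (d) => u v; exists u, v.
have h1 : 0 <= u - b * v.
  have := cond b s; rewrite nuB zs -mulrA -polarD !addNr polar0 mulr1 dE => /(_ erefl).
  by rewrite (ltnW qs) leqnn => /(_ isT isT); rewrite /= mul1r.
have h2 : 0 <= u + a * v.
  have := cond (- a) q; rewrite nuA zq -mulrA -polarD addNr subrr polar0 mulr1 dE => /(_ erefl).
  by rewrite (ltnW qs) leqnn => /(_ isT isT); rewrite /= mul1r mulNr opprK.
have [] := wedge_inv a0 b0 h1 h2; rewrite -dE => d1 Wd.
rewrite E mulf_neq0 //; split=> //.
by have -> : real_complex R (1 - r) / (real_complex R (1 - r) * (1 + d)) = 1 / (1 + d)
  by rewrite invfM mulrA divff.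
Qed.
End Separation.

(** * Nonvanishing of the determinant *)

Lemma short_det_recursion (R : rcfType) (C : comNzRingType) (io : {rmorphism R -> C}) n
    (B : 'M[R]_n) (z : C) k : (1 < k)%N ->
  cycle_recursion (cycle_weight B) io z k (short_det (1%:M - z *: map_mx io B) k).
Proof.
move=> k1; split=> [|U v vU]; first exact: short_det0.
by rewrite (short_det_step _ _ k1 vU); under eq_bigr do rewrite cycle_weight_map.
Qed.

Lemma det_separation (R : realType) (n q s : nat) (l A B a b : R) (nu z : R[i]) (t : R)
    (M : 'M[R]_n) :
  (1 < q)%N -> (q < s)%N -> (n < q.*2)%N -> coprime q s ->
  0 <= l -> 0 < A -> 0 < B -> A + B < pi -> q%:R * B + s%:R * A = pi *+ 2 ->
  z ^+ q = polar (q%:R * l) (- A) -> z ^+ s = polar (s%:R * l) B ->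
  nu = (1 +i* (- a))%C * polar (- (q%:R * l)) A ->
  nu = (1 +i* b)%C * polar (- (s%:R * l)) (- B) -> 1 < complex.Re nu ->
  0 <= t < 1 -> (forall i j, 0 <= M i j) -> (forall i, \sum_j M i j <= t) ->
  \det (1%:M - z *: map_mx (real_complex R) M) != 0.
Proof.
move=> q1 qs n2q cop l0 A0 B0 AB qsAB zq zs nuA nuB nu1 t01 M0 Mt.
have q0 := ltnW q1.
have Mt' i : \sum_j `|M i j| <= t.
  by apply: le_trans (Mt i); apply: ler_sum => j _; rewrite ger0_norm.
have /andP[_ t1] := t01.
pose f := short_det (1%:M - 1 *: M) q.
pose F := short_det (1%:M - z *: map_mx (real_complex R) M) q.
have recid k : (1 < k)%N -> cycle_recursion (cycle_weight M) id 1 k (short_det (1%:M - 1 *: M) k).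
  move=> k1; have := short_det_recursion (@idfun R : {rmorphism R -> R}) M 1 k1.
  by rewrite map_mx_id.
have beta0 X : 0 <= cycle_weight M X by apply: cycle_weight_ge0.
(* The comparison with all cycles uses the length bound [n.+1], which must exceed 1. *)
case: (posnP n) => [n0|n_gt0].
  by move: M {M0 Mt Mt' f F recid beta0}; rewrite n0 => M; rewrite det_mx00 oner_neq0.
have f0 U : 0 < f U.
  apply: (cycle_recursion_gt0 beta0 (recid q q1) (recid n.+1 _)) => // V.
  exact: short_det_all_gt0 t01 Mt'.
have [W1 WM] := (@wedge1 R a b, @wedgeM R a b).
have resolv := wedge_resolvent l0 A0 B0 AB qsAB q0 qs cop zq zs nuA nuB nu1.
have H := cycle_recursion_ratio beta0 W1 WM resolv (recid q q1) (short_det_recursion (real_complex R) M z q1) f0.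
have [FT _] := H _ _ (subxx setT).
apply/eqP => det0.
have := det_step (map_mx (real_complex R) M) z q1 n2q; rewrite det0 -/F => /eqP.
rewrite eq_sym subr_eq0 => /eqP FE.
pose g X := cycle_weight M X * f (setT :\: X) / f setT.
(* The same expansion at z = 1 gives det(1 - M), which is positive; hence the total weight is below
   1. *)
have sg : \sum_(X : {set 'I_n} | (q <= #|X|)%N) g X < 1.
  have := det1B_gt0 t1 Mt'; rewrite -{1}[M]scale1r (det_step M 1 q1 n2q).
  rewrite subr_gt0 -/f -mulr_suml ltr_pdivrMr // mul1r; congr (_ < _).
  by apply: eq_bigr => X _; rewrite expr1n mul1r.
pose w X := (F (setT :\: X) / F setT) * (real_complex R (f setT) / real_complex R (f (setT :\: X))).
have f0' U : real_complex R (f U) != 0 by rewrite fmorph_eq0 gt_eqF.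
have nuE : complex.Re nu = \sum_(X : {set 'I_n} | (q <= #|X|)%N) g X * complex.Re (nu * (z ^+ #|X| * w X)).
  have {1}-> : nu = \sum_(X : {set 'I_n} | (q <= #|X|)%N) real_complex R (g X) * (nu * (z ^+ #|X| * w X)).
    rewrite -[LHS]mulr1 -(divff FT) -/F {1}FE mulr_suml mulr_sumr.
    apply: eq_bigr => X _; rewrite cycle_weight_map /g /w !rmorphM fmorphV -/F; field.
    by rewrite FT !f0'.
  by rewrite Re_sum; apply: eq_bigr => X _; rewrite ReZ.
have : complex.Re nu <= \sum_(X : {set 'I_n} | (q <= #|X|)%N) g X.
  rewrite nuE; apply: ler_sum => X qX; rewrite -[leRHS]mulr1 ler_wpM2l //.
    by rewrite !mulr_ge0 ?invr_ge0 // ltW.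
  apply: (Re_nu_pow_le1 l0 A0 B0 AB qsAB q0 qs cop zq zs nuA nuB nu1) => //.
    (* Cycle lengths are at most n < 2q < q + s, so they lie in the window. *)
    by apply: leq_ltn_trans (max_card _) _; rewrite card_ord; move: n2q qs; clear; lia.
  by have [_] := H _ _ (subsetT (setT :\: X)).
by move=> h; have := le_lt_trans h sg; rewrite ltNge ltW.
Qed.

(** * Points on rays and the exclusion bound for [Theta] *)

Section Expi.
Variable R : realType.
Implicit Types (x y t : R).

Lemma polarE x y : polar x y = (expR x)%:C%C * expi y.
Proof. by rewrite /polar /expi mulcE; apply: eqc; ring. Qed.

Lemma expiD x y : expi (x + y) = expi x * expi y.
Proof. by have := polarD 0 x 0 y; rewrite addr0 !polarE expR0 rmorph1 !mul1r. Qed.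

Lemma expiX x m : expi x ^+ m = expi (m%:R * x).
Proof. by have := polarX 0 x m; rewrite mulr0 !polarE expR0 rmorph1 !mul1r. Qed.

Lemma expiN_inj x y : expi x = expi y -> expi (- x) = expi (- y).
Proof. by rewrite /expi !cosN !sinN => -[-> ->]. Qed.

Lemma norm_expi x : `|expi x| = 1.
Proof. by rewrite normc_def /= cos2Dsin2 sqrtr1. Qed.

Lemma norm_rexpi r x : 0 <= r -> `|r%:C%C * expi x| = r%:C%C.
Proof. by move=> r0; rewrite normrM norm_expi mulr1 ger0_norm // lecR. Qed.
End Expi.

Lemma Theta_norm_le1 (R : realType) n (z : R[i]) : Theta n z -> `|z| <= 1.
Proof.
case=> A [[A0 A1]]; apply: eigenvalue_norm_le => i.
rewrite -(rmorph1 (real_complex R)) -(A1 i) rmorph_sum; apply: ler_sum => j _.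
by rewrite mxE ger0_norm // lecR.
Qed.

(** Were the bound violated, it would still be violated at radius t rho for some t < 1 close to 1.
    Then [det_separation] applies to t times the stochastic matrix, although z = 1 / (t lambda)
    makes the determinant vanish. *)
Lemma Theta_sin_bound (R : realType) (n q s : nat) (A B theta rho : R) :
  (1 < q)%N -> (q < s)%N -> (n < q.*2)%N -> coprime q s ->
  0 < A -> 0 < B -> A + B < pi -> q%:R * B + s%:R * A = pi *+ 2 ->
  expi (q%:R * theta) = expi A -> expi (s%:R * theta) = expi (- B) ->
  0 < rho -> Theta n (rho%:C%C * expi theta) ->
  rho ^+ s * sin A + rho ^+ q * sin B <= sin (A + B).
Proof.
move=> q1 qs n2q cop A0 B0 AB qsAB eA eB rho0 Th; rewrite leNgt; apply/negP => G0.
have rho1 : rho <= 1.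
  rewrite -lecR -(norm_rexpi theta (ltW rho0)); exact: (Theta_norm_le1 Th).
have sA : 0 < sin A by apply: sin_gt0_pi; rewrite A0; lra.
have sB : 0 < sin B by apply: sin_gt0_pi; rewrite B0; lra.
have sL : 0 < sin (A + B) by apply: sin_gt0_pi; rewrite AB addr_gt0.
pose a1 := rho ^+ s * sin A; pose a2 := rho ^+ q * sin B.
have a10 : 0 < a1 by rewrite mulr_gt0 // exprn_gt0.
have a20 : 0 < a2 by rewrite mulr_gt0 // exprn_gt0.
have s0 : 0 < s%:R :> R by rewrite ltr0n; apply: leq_trans qs.
(* Chosen so that replacing t^s by its lower bound 1 - se, where t = e^(-e), costs only half of the
   excess over sin(A + B). *)
pose e := (a1 + a2 - sin (A + B)) / (2 * s%:R * (a1 + a2)).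
have e0 : 0 < e by rewrite divr_gt0 ?subr_gt0 // !mulr_gt0 ?addr_gt0.
have see : s%:R * e * (a1 + a2) = (a1 + a2 - sin (A + B)) / 2.
  by rewrite /e; field; rewrite !gt_eqF ?addr_gt0.
pose t := expR (- e).
have t0 : 0 < t by apply: expR_gt0.
have t1 : t < 1 by rewrite expR_lt1 oppr_lt0.
have Gt : sin (A + B) < (t * rho) ^+ s * sin A + (t * rho) ^+ q * sin B.
  have ts : 1 - s%:R * e <= t ^+ s.
    by rewrite /t -expRM_natl mulrN; apply: expR_ge1Dx.
  have tq : t ^+ s <= t ^+ q by apply: ler_wiXn2l; [exact: ltW | exact: ltW | exact: ltnW].
  rewrite !exprMn -!mulrA -/a1 -/a2.
  have h1 : (1 - s%:R * e) * (a1 + a2) <= t ^+ s * (a1 + a2) by rewrite ler_pM2r // addr_gt0.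
  have h2 : t ^+ s * a2 <= t ^+ q * a2 by rewrite ler_pM2r.
  by move: G0 h1; rewrite -/a1 -/a2 mulrBl see mul1r; lra.
have [l El] : exists l, expR (- l) = t * rho.
  by exists (- ln (t * rho)); rewrite opprK lnK // posrE mulr_gt0.
have l0 : 0 <= l.
  by rewrite -oppr_le0 -expR_le1 El; apply: mulr_ile1 => //; exact: ltW.
pose z := polar l (- theta).
pose E1 := expR (- (q%:R * l)); pose E2 := expR (- (s%:R * l)).
have E1E : E1 = (t * rho) ^+ q by rewrite -El -expRM_natl mulrN.
have E2E : E2 = (t * rho) ^+ s by rewrite -El -expRM_natl mulrN.
have E10 : E1 != 0 by rewrite gt_eqF // expR_gt0.
have E20 : E2 != 0 by rewrite gt_eqF // expR_gt0.
(* These solve (1 - ai) e^(-ql + iA) = (1 + bi) e^(-sl - iB). The common value [nu] satisfies Re nu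
   sin(A + B) = E1 sin B + E2 sin A. *)
pose a := (E2 / E1 - cos (A + B)) / sin (A + B).
pose b := (E1 / E2 - cos (A + B)) / sin (A + B).
pose nu := (1 +i* (- a))%C * polar (- (q%:R * l)) A.
have zq : z ^+ q = polar (q%:R * l) (- A).
  by rewrite polarX !polarE mulrN (expiN_inj eA).
have zs : z ^+ s = polar (s%:R * l) B.
  by rewrite polarX !polarE mulrN (expiN_inj eB) opprK.
have sL0 : sin (A + B) != 0 by rewrite gt_eqF.
have sBE : sin (A + B) * cos A - cos (A + B) * sin A = sin B by rewrite -sinB addrAC subrr add0r.
have sAE : sin (A + B) * cos B - cos (A + B) * sin B = sin A by rewrite -sinB addrK.
have cBE : cos (A + B) * cos A + sin (A + B) * sin A = cos B by rewrite -cosB addrAC subrr add0r.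
have cAE : cos (A + B) * cos B + sin (A + B) * sin B = cos A by rewrite -cosB addrK.
have nuB : nu = (1 +i* b)%C * polar (- (s%:R * l)) (- B).
  rewrite /nu /polar !mulcE -/E1 -/E2 cosN sinN; apply: eqc.
    apply: (mulIf sL0).
    have -> : (1 * (E1 * cos A) - - a * (E1 * sin A)) * sin (A + B) =
       E1 * (sin (A + B) * cos A - cos (A + B) * sin A) + E2 * sin A.
      by rewrite /a; field; rewrite sL0.
    have -> : (1 * (E2 * cos B) - b * (E2 * - sin B)) * sin (A + B) =
       E2 * (sin (A + B) * cos B - cos (A + B) * sin B) + E1 * sin B.
      by rewrite /b; field; rewrite sL0.
    by rewrite sAE sBE addrC.
  apply: (mulIf sL0).
  have -> : (1 * (E1 * sin A) + - a * (E1 * cos A)) * sin (A + B) =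
       E1 * (cos (A + B) * cos A + sin (A + B) * sin A) - E2 * cos A.
    by rewrite /a; field; rewrite sL0.
  have -> : (1 * (E2 * - sin B) + b * (E2 * cos B)) * sin (A + B) =
       - E2 * (cos (A + B) * cos B + sin (A + B) * sin B) + E1 * cos B.
    by rewrite /b; field; rewrite sL0.
  by rewrite cAE cBE mulNr addrC.
have nu1 : 1 < complex.Re nu.
  rewrite ReM_polar -/E1 -(ltr_pM2r sL) mul1r.
  have -> : E1 * (cos A - - a * sin A) * sin (A + B) =
       E1 * (sin (A + B) * cos A - cos (A + B) * sin A) + E2 * sin A.
    by rewrite /a; field; rewrite sL0.
  by rewrite sBE E1E E2E; lra.
have [S [[S0 S1]]] := Th.
move/eigenvalueP => [u uS u0].
have := @det_separation R n q s l A B a b nu z t (t *: S) q1 qs n2q cop l0 A0 B0 AB qsAB zq zs erefl nuB nu1.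
have -> : \det (1%:M - z *: map_mx (real_complex R) (t *: S)) = 0.
  apply/eqP/det0P; exists u => //.
  rewrite mulmxBr mulmx1 -scalemxAr map_mxZ -scalemxAr uS !scalerA.
  have -> : z * real_complex R t * (rho%:C%C * expi theta) = 1.
    transitivity (z * polar (- l) theta); last by rewrite -polarD subrr addNr polar0.
    by rewrite polarE El rmorphM /= !mulrA.
  by rewrite scale1r subrr.
have t01 : 0 <= t < 1 by rewrite ltW.
have S0' i j : 0 <= (t *: S) i j by rewrite mxE mulr_ge0 // ltW.
have S1' i : \sum_j (t *: S) i j <= t.
  by rewrite -[leRHS]mulr1 -(S1 i) mulr_sumr; apply: ler_sum => j _; rewrite mxE.
by rewrite eqxx => /(_ t01 S0' S1').
Qed.

(** * Constructions of stochastic matrices with given eigenvalues *)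

Lemma eigenvalue_tr (F : fieldType) n (M : 'M[F]_n) (a : F) :
  eigenvalue M^T a -> eigenvalue M a.
Proof.
move=> /eigenvalueP[v vM v0].
have /eqP/det0P[u u0 uM] : \det (a%:M - M) = 0.
  rewrite -det_tr; apply/eqP/det0P; exists v => //.
  by rewrite linearB /= tr_scalar_mx mulmxBr vM mul_mx_scalar subrr.
apply/eigenvalueP; exists u => //.
by move/eqP: uM; rewrite mulmxBr mul_mx_scalar subr_eq0 => /eqP.
Qed.

Lemma sum_delta (K : nzRingType) n (k : nat) (g : nat -> K) : (k < n)%N ->
  \sum_(j < n) (val j == k)%:R * g j = g k.
Proof.
move=> kn; rewrite (bigD1 (Ordinal kn)) //= eqxx mul1r big1 ?addr0 // => j jk.
have -> : (val j == k) = false by apply: contraNF jk => /eqP jk; apply/eqP/val_inj.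
by rewrite mul0r.
Qed.

(** The matrix is the companion matrix of f_alpha on the first [s] coordinates and the identity on
    the others; (1, z, ..., z^(s-1), 0, ..., 0) is a column eigenvector. *)
Lemma Theta_trinomial (R : realType) (n q s : nat) (alpha : R) (z : R[i]) :
  (0 < q)%N -> (q < s)%N -> (s <= n)%N -> 0 <= alpha <= 1 ->
  f_alpha q s alpha z = 0 -> Theta n z.
Proof.
move=> q0 qs sn /andP[al0 al1] fz.
have n0 : (0 < n)%N by move: q0 qs sn; lia.
pose a (i j : nat) : R :=
  if (i.+1 < s)%N then (j == i.+1)%:R else
  if i.+1 == s then (1 - alpha) * (j == s - q)%N%:R + alpha * (j == 0%N)%:R else (j == i)%:R.
pose M : 'M[R]_n := \matrix_(i, j) a i j.
(* Stated for any morphism [f], to serve both the real row sums and the complex eigenvector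
   equation. *)
have sumM (K : nzRingType) (f : {rmorphism R -> K}) (g : nat -> K) (i : 'I_n) :
  \sum_j f (M i j) * g j = if (i.+1 < s)%N then g i.+1 else
   if i.+1 == s :> nat then f (1 - alpha) * g (s - q)%N + f alpha * g 0%N else g i.
  under eq_bigr do rewrite mxE /a.
  case: ifP => h1; first by under eq_bigr do rewrite rmorph_nat; rewrite sum_delta //; lia.
  case: ifP => h2; last by under eq_bigr do rewrite rmorph_nat; rewrite sum_delta.
  under eq_bigr do rewrite rmorphD !rmorphM !rmorph_nat mulrDl -!mulrA.
  by rewrite big_split /= -!mulr_sumr !sum_delta //; lia.
exists M; split.
  split=> [i j|i].
    rewrite mxE /a; case: ifP => _; first exact: ler0n.
    case: ifP => _; last exact: ler0n.
    by rewrite addr_ge0 // mulr_ge0 ?ler0n ?subr_ge0.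
  have := @sumM _ idfun (fun=> 1) i; rewrite /=.
  under eq_bigr do rewrite mulr1; move=> ->; rewrite !mulr1 subrK.
  by do 2!case: ifP => // _.
(* [eigenvalue] speaks of row vectors, hence the transpose. *)
apply: eigenvalue_tr; apply/eigenvalueP.
pose g (i : nat) := if (i < s)%N then z ^+ i else 0.
exists (\row_i g i); last first.
  apply/eqP => /rowP/(_ (Ordinal n0)); rewrite !mxE /= /g.
  by have -> : (0 < s)%N by [move: q0 qs; lia]; move/eqP; rewrite expr0 oner_eq0.
apply/rowP => i; rewrite mxE [RHS]mxE [in RHS]mxE.
transitivity (\sum_j real_complex R (M i j) * g j).
  by apply: eq_bigr => j _; rewrite !mxE mulrC.
rewrite sumM /g; case: ifP => h1; first by rewrite h1 (ltnW h1) exprS.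
case: ifP => h2; last by case: ifP => h3; [lia | rewrite mulr0].
have -> : (s - q < s)%N by move: q0 qs; lia.
have -> : (0 < s)%N by move: q0 qs; lia.
have -> : (i < s)%N by lia.
rewrite -exprS (eqP h2) expr0 mulr1.
by move/eqP: fz; rewrite /f_alpha -addrA -opprD subr_eq0 => /eqP.
Qed.

Lemma Theta_conj (R : realType) n (z : R[i]) : Theta n z -> Theta n (z^*)%C.
Proof.
case=> A [As Az]; exists A; split; first exact: As.
rewrite -(eigenvalue_map (conjc : {rmorphism R[i] -> R[i]})) in Az.
rewrite -map_mx_comp in Az.
have E : map_mx (conjc \o real_complex R) A = map_mx (real_complex R) A.
  by apply/matrixP => i j; rewrite !mxE /= oppr0.
by rewrite E in Az.
Qed.

(** As the rows sum to 1 and z is not 1, the entries of a row eigenvector sum to 0. The stochastic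
    matrix with a first column of ones therefore kills it, and a convex combination with that matrix
    scales the eigenvalue. *)
Lemma Theta_scale (R : realType) n (z : R[i]) (t : R) : z != 1 -> 0 <= t <= 1 ->
  Theta n z -> Theta n (t%:C%C * z).
Proof.
move=> z1 /andP[t0 t1] [A [[A0 A1] /eigenvalueP[u uA u0]]].
case: n A A0 A1 u uA u0 => [|n] A A0 A1 u uA u0.
  by case/eqP: u0; apply/rowP => -[].
have su : \sum_j u 0 j = 0.
  have : \sum_j (u *m map_mx (real_complex R) A) 0 j = \sum_j u 0 j.
    under eq_bigr do rewrite mxE; rewrite exchange_big; apply: eq_bigr => i _ /=.
    rewrite -mulr_sumr -[RHS]mulr1 -(rmorph1 (real_complex R)) -(A1 i) rmorph_sum.
    by under eq_bigr do rewrite mxE.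
  rewrite uA; under eq_bigr do rewrite mxE; rewrite -mulr_sumr => /eqP.
  by rewrite -subr_eq0 -{2}[\sum_j _]mul1r -mulrBl mulf_eq0 subr_eq0 (negbTE z1) => /eqP.
exists (t *: A + (1 - t) *: \matrix_(i < n.+1, j < n.+1) (j == 0)%:R); split.
  split=> [i j|i].
    by rewrite !mxE addr_ge0 // mulr_ge0 ?ler0n ?subr_ge0.
  under eq_bigr do rewrite !mxE; rewrite big_split /= -!mulr_sumr A1 mulr1.
  by rewrite (bigD1 ord0) //= big1 ?addr0 ?mulr1 1?addrC ?subrK // => j /negbTE->.
apply/eigenvalueP; exists u => //.
rewrite map_mxD !map_mxZ mulmxDr -!scalemxAr uA scalerA.
have -> : u *m map_mx (real_complex R) (\matrix_(i < n.+1, j < n.+1) (j == 0)%:R) = 0.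
  apply/rowP => j; rewrite !mxE; under eq_bigr do rewrite !mxE.
  by rewrite -mulr_suml su mul0r.
by rewrite scaler0 addr0.
Qed.

(** * The arc of a Farey pair *)

(** The right neighbour is built explicitly: [b] is the largest denominator up to [n] with bp = -1
    modulo q, and a = (bp + 1)/q. Adjacency excludes a/b < r/s. If a/b > r/s, then s = (rq - ps)b +
    (as - rb)q >= b + q > n. So the two reduced fractions coincide. *)
Lemma farey_pair_det n p q r s : (1 < q)%N -> (q < s)%N ->
  farey_pair n p q r s -> (r * q = p * s + 1)%N.
Proof.
move=> q1 qs [[pq [qn cpq]] [[rs [sn crs]] [lt adj]]].
have p0 : (0 < p)%N by case: (posnP p) cpq => // ->; rewrite /coprime gcd0n; move: q1; lia.
have [km kn kE _] := egcdnP q p0; rewrite (eqP cpq) in kE.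
(* [km] inverts [p] modulo [q], so [c] is the residue of -1/p. *)
pose c := ((q - 1) * km %% q)%N.
have cq : (c < q)%N by rewrite ltn_pmod // ltnW.
pose b := (c + (n - c) %/ q * q)%N.
have bE : (b + (n - c) %% q = n)%N.
  by rewrite /b -addnA -divn_eq subnKC // ltnW // (leq_trans cq).
have bn : (b <= n)%N by rewrite -bE leq_addr.
have nqb : (n < b + q)%N by rewrite -{1}bE ltn_add2l ltn_pmod // ltnW.
have : (q %| b * p + 1)%N.
  have cE := divn_eq ((q - 1) * km) q.
  rewrite -(dvdn_addl (b * p + 1) (dvdn_mull ((q - 1) * km %/ q * p) (dvdnn q))).
  apply/dvdnP; exists ((q - 1) * kn + 1 + (n - c) %/ q * p)%N.
  have : ((q - 1) * km * p = (q - 1) * (kn * q + 1))%N by rewrite -kE mulnA.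
  rewrite {1}cE -/c /b.
  have : (q - 1 + 1 = q)%N by lia.
  move: (q - 1)%N (c) (_ %/ q)%N ((n - c) %/ q)%N => q' c' K m.
  by clear; move=> <-; lia.
move=> /dvdnP[a aE]; have b0 : (0 < b)%N by move: nqb qn; lia.
have a0 : (0 < a)%N by case: (a) aE; lia.
have cab : coprime a b.
  by apply/(coprimeP _ a0); exists (q, p); rewrite /= (mulnC q) -aE (mulnC p); lia.
have r0 : (0 < r)%N by case: (r) lt; lia.
case: (ltngtP (a * s) (r * b)) => [asrb|rbas|E].
- exfalso; apply: (adj a b); last by split=> //; rewrite -aE; lia.
  split; last by [].
  have s0 : (0 < s)%N by apply: leq_trans qs.
  rewrite -(ltn_pmul2r s0); apply: leq_trans asrb _.
  by rewrite [leqRHS]mulnC leq_mul2r ltnW ?orbT.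
- exfalso.
  have E1 : (a * q * s = b * p * s + s)%N by rewrite -aE mulnDl mul1n.
  have h1 : (p * s * b + b <= r * q * b)%N by rewrite -mulSnr leq_mul2r lt orbT.
  have h2 : (r * b * q + q <= a * s * q)%N by rewrite -mulSnr leq_mul2r rbas orbT.
  by move: sn nqb E1 h1 h2; clear; lia.
have ra : r = a.
  apply/eqP; rewrite eqn_dvd; apply/andP; split.
    by rewrite -(Gauss_dvdl a crs) E dvdn_mulr.
  by rewrite -(Gauss_dvdl r cab) -E dvdn_mulr.
have sb : s = b by apply/eqP; rewrite -(eqn_pmul2l r0) {1}ra E.
by rewrite sb ra -aE mulnC.
Qed.

Definition arc_fun (R : realType) (q s : nat) (theta rho : R) : R :=
  rho ^+ s * sin (q%:R * theta) - rho ^+ q * sin (s%:R * theta) + sin ((s - q)%:R * theta).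

Section Arc.
Variable R : realType.
Implicit Types (theta rho alpha A B : R).

Lemma expiD2pi theta m : expi (theta + 2 * pi * m%:R) = expi theta.
Proof.
have -> : 2 * pi * m%:R = (pi *+ 2) *+ m :> R by rewrite -mulr_natr -[pi *+ 2]mulr_natr; ring.
by rewrite /expi (periodicn (@cosD2pi R)) (periodicn (@sinD2pi R)).
Qed.

(** The imaginary part, divided by rho^(s-q), is the first equation; inserting it into the real part
    gives the second. Their sum is the displayed equation in [rho], and the second determines
    [alpha]. *)
Lemma f_alpha_expi_eq0 q s A B theta rho alpha : (q < s)%N -> 0 < rho ->
  expi (s%:R * theta) = expi (- B) -> expi ((s - q)%:R * theta) = expi (- (A + B)) ->
  sin (A + B) != 0 ->
  (f_alpha q s alpha (rho%:C%C * expi theta) = 0) <->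
  ((1 - alpha) * sin (A + B) = rho ^+ q * sin B /\ alpha * sin (A + B) = rho ^+ s * sin A).
Proof.
move=> qs rho0 es eL sL.
have sE : rho ^+ s = rho ^+ (s - q) * rho ^+ q by rewrite -exprD subnK // ltnW.
have rsq : rho ^+ (s - q) != 0 by rewrite expf_neq0 // gt_eqF.
have fE : f_alpha q s alpha (rho%:C%C * expi theta) =
   ((rho ^+ s * cos B - (1 - alpha) * (rho ^+ (s - q) * cos (A + B)) - alpha) +i*
    ((1 - alpha) * (rho ^+ (s - q) * sin (A + B)) - rho ^+ s * sin B))%C.
  rewrite /f_alpha !exprMn !expiX es eL /expi !cosN !sinN -!(rmorphXn (real_complex R)) /=.
  by apply: eqc; ring.
rewrite fE; move: (1 - alpha) (subKr 1 alpha) => beta be.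
have sAE : sin (A + B) * cos B - cos (A + B) * sin B = sin A by rewrite -sinB addrK.
split=> [[h1 h2]|[h1 h2]].
  have h3 : beta * sin (A + B) = rho ^+ q * sin B.
    apply: (mulfI rsq); move: h2; rewrite sE; lra.
  split=> //; rewrite -sAE mulrBr.
  have -> : alpha = rho ^+ s * cos B - beta * (rho ^+ (s - q) * cos (A + B)) by lra.
  rewrite mulrBl; congr (_ - _); first ring.
  transitivity (rho ^+ (s - q) * cos (A + B) * (beta * sin (A + B))); first ring.
  by rewrite h3 sE; ring.
apply: eqc.
  apply: (mulIf sL); rewrite mul0r !mulrBl h2 -sAE.
  have -> : beta * (rho ^+ (s - q) * cos (A + B)) * sin (A + B) = rho ^+ (s - q) * cos (A + B) * (beta * sin (A + B)) by ring.
  by rewrite h1 sE; ring.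
have -> : beta * (rho ^+ (s - q) * sin (A + B)) = rho ^+ (s - q) * (beta * sin (A + B)) by ring.
by rewrite h1 sE; ring.
Qed.

Lemma arc_root q s (a b c : R) : (0 < q)%N -> (0 < s)%N -> 0 < c -> c < a + b ->
  exists2 rho, 0 < rho < 1 & rho ^+ s * a + rho ^+ q * b = c.
Proof.
move=> q0 s0 c0 cab.
pose P := a *: 'X^s + b *: 'X^q - c%:P : {poly R}.
have PE x : P.[x] = x ^+ s * a + x ^+ q * b - c.
  by rewrite /P !hornerE mulrC [b * _]mulrC.
have [|x /andP[x0 x1]] := @poly_ivt _ P 0 1 ler01.
- by rewrite !PE !expr0n !gtn_eqF // !expr1n !mul0r !mul1r; apply/andP; split; lra.
rewrite rootE PE => /eqP h; exists x; last by lra.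
rewrite !lt_neqAle x0 x1 !andbT; apply/andP; split; apply/eqP => hx.
  by move: h; rewrite -hx !expr0n !gtn_eqF // !mul0r; lra.
by move: h; rewrite hx !expr1n; lra.
Qed.

Lemma arc_mono q s (a b : R) : (0 < q)%N -> 0 < a -> 0 < b ->
  forall x y, 0 < x -> x < y -> x ^+ s * a + x ^+ q * b < y ^+ s * a + y ^+ q * b.
Proof.
move=> q0 a0 b0 x y x0 xy; have y0 := lt_trans x0 xy; apply: ler_ltD.
  by rewrite ler_pM2r //; apply: lerXn2r; rewrite ?nnegrE ltW.
by rewrite ltr_pM2r // ltr_pXn2r // nnegrE ltW.
Qed.

Variables (n p q r s : nat).
Hypotheses (q1 : (1 < q)%N) (qs : (q < s)%N) (sn : (s <= n)%N) (n2q : (n < q.*2)%N)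
  (det1 : (r * q = p * s + 1)%N).

Definition in_arc theta := 2 * pi * p%:R / q%:R < theta < 2 * pi * r%:R / s%:R.

Local Notation angA theta := (q%:R * theta - 2 * pi * p%:R).
Local Notation angB theta := (2 * pi * r%:R - s%:R * theta).

(** The last identity is 2 pi (rq - ps) = 2 pi; since 2 <= q < s, it yields 2(A + B) < 2 pi. *)
Lemma arc_angles theta : in_arc theta ->
  [/\ 0 < angA theta, 0 < angB theta, angA theta + angB theta < pi &
      q%:R * angB theta + s%:R * angA theta = pi *+ 2].
Proof.
move=> /andP[h1 h2].
have q0R : 0 < q%:R :> R by rewrite ltr0n ltnW.
have s0R : 0 < s%:R :> R by rewrite ltr0n (leq_trans _ qs).
have A0 : 0 < angA theta by rewrite subr_gt0 [ltRHS]mulrC -ltr_pdivrMr.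
have B0 : 0 < angB theta by rewrite subr_gt0 [ltLHS]mulrC -ltr_pdivlMr.
have E : q%:R * angB theta + s%:R * angA theta = pi *+ 2.
  have : r%:R * q%:R = p%:R * s%:R + 1 :> R by rewrite -!natrM det1 natrD.
  by rewrite -[pi *+ 2]mulr_natl => H; rewrite !mulrBr; have := congr1 (fun x => 2 * pi * x) H; lra.
split=> //.
have q2 : 2 <= q%:R :> R by rewrite ler_nat.
have qsR : q%:R < s%:R :> R by rewrite ltr_nat.
rewrite -[pi *+ 2]mulr_natl in E.
have h3 : q%:R * angA theta < s%:R * angA theta by rewrite ltr_pM2r.
have h4 : 2 * (angA theta + angB theta) <= q%:R * (angA theta + angB theta) by rewrite ler_pM2r // addr_gt0.
by move: h3 h4 E; move: (angA theta) (angB theta) => A B; lra.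
Qed.

Lemma arc_expi theta :
  [/\ expi (q%:R * theta) = expi (angA theta), expi (s%:R * theta) = expi (- angB theta) &
      expi ((s - q)%:R * theta) = expi (- (angA theta + angB theta))].
Proof.
(* Needed for the natural subtraction [r - p], the number of full turns in the third identity, to be
   a true difference. *)
have pr : (p <= r)%N by rewrite -(leq_pmul2r (ltnW q1)) det1; apply: leq_trans (leq_addr _ _); rewrite leq_mul2l ltnW ?orbT.
split.
- by rewrite -(expiD2pi (angA theta) p) subrK.
- by rewrite -(expiD2pi (- angB theta) r) opprB subrK.
- rewrite -(expiD2pi (- _) (r - p)); congr expi; rewrite !natrB ?(ltnW qs) //; ring.
Qed.

Lemma arc_funE theta rho : arc_fun q s theta rho =
  rho ^+ s * sin (angA theta) + rho ^+ q * sin (angB theta) - sin (angA theta + angB theta).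
Proof.
have [e1 e2 e3] := arc_expi theta; rewrite /arc_fun.
have -> : sin (q%:R * theta) = sin (angA theta) by case: e1.
have -> : sin (s%:R * theta) = - sin (angB theta) by case: e2 => _ ->; rewrite sinN.
have -> : sin ((s - q)%:R * theta) = - sin (angA theta + angB theta) by case: e3 => _ ->; rewrite sinN.
by rewrite mulrN opprK.
Qed.
End Arc.

(** * Small discs in polar coordinates *)

Section PolarNeighbourhood.
Local Open Scope classical_set_scope.
Local Open Scope ring_scope.
Variable R : realType.

Lemma atan_norm_le (x : R) : `|atan x| <= `|x|.
Proof.
wlog x0 : x / 0 <= x.
  move=> H; have [/H//|x0] := leP 0 x.
  by rewrite -normrN -atanN -[leRHS]normrN; apply: H; lra.
have ha : {within `[0, x], continuous (@atan R)}.
  by apply: continuous_subspaceT => y; apply: continuous_atan.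
have [c _] := MVT_segment x0 (fun y _ => is_derive1_atan y) ha.
rewrite atan0 !subr0 => ->; rewrite normrM ler_piMl // normfV.
rewrite invf_le1; last by rewrite normr_gt0 gt_eqF // ltr_pwDl ?sqr_ge0.
by apply: le_trans (ler_norm _); rewrite lerDl sqr_ge0.
Qed.

Lemma polar_neighbourhood (theta rho d : R) : 0 < rho -> 0 < d ->
  exists2 e : R, 0 < e & forall w : R[i], `|w - rho%:C%C * expi theta| < e%:C%C ->
    exists rho' theta' : R,
      [/\ w = rho'%:C%C * expi theta', 0 < rho', `|rho' - rho| < d & `|theta' - theta| < d].
Proof.
(* After rotation by -theta the centre is real: [rho / 2] keeps the real part above [rho / 2], [d]
   controls the modulus, and [d * (rho / 2)] controls the angle, as |atan(b/a)| <= |b|/a. *)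
move=> rho0 d0; pose e := Num.min (rho / 2) (Num.min d (d * (rho / 2))).
have r20 : 0 < rho / 2 by lra.
exists e; first by rewrite !lt_min d0 r20 mulr_gt0.
move=> w wE; pose u := w * expi (- theta).
have uE : w = u * expi theta.
  by rewrite -mulrA -expiD addNr /expi cos0 sin0 mulr1.
have : `|u - rho%:C%C| < e%:C%C.
  by move: wE; rewrite uE -mulrBl normrM norm_expi mulr1.
have [a [b uab]] : exists a b, u = (a +i* b)%C by case: (u) => a b; exists a, b.
have -> : u - rho%:C%C = ((a - rho) +i* b)%C by rewrite uab; apply: eqc; rewrite /= ?subr0.
rewrite normc_def /= ltcR => ue.
have ae : `|a - rho| < e.
  by apply: le_lt_trans ue; rewrite -sqrtr_sqr ler_sqrt ?addr_ge0 ?sqr_ge0 // lerDl sqr_ge0.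
have be : `|b| < e.
  by apply: le_lt_trans ue; rewrite -sqrtr_sqr ler_sqrt ?addr_ge0 ?sqr_ge0 // lerDr sqr_ge0.
have [e1 e2 e3] : [/\ e <= rho / 2, e <= d & e <= d * (rho / 2)].
  by split; rewrite !ge_min lexx ?orbT.
have a0 : rho / 2 < a by move: ae; rewrite ltr_norml => /andP[]; lra.
have a00 : 0 < a by lra.
pose f := atan (b / a).
have cf : 0 < cos f by apply: cos_gt0_pihalf; rewrite atan_gtNpi2 atan_ltpi2.
have sf : sin f = b / a * cos f by rewrite -[b / a]atanK /tan divfK ?gt_eqF.
pose m := a / cos f; have m0 : 0 < m by apply: divr_gt0.
have um : u = m%:C%C * expi f.
  rewrite uab /expi sf /m mulcE; apply: eqc; rewrite mul0r ?subr0 ?addr0.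
    by rewrite divfK ?gt_eqF.
  by field; rewrite !gt_eqF.
exists m, (theta + f); rewrite m0; split=> //.
- by rewrite uE um -mulrA -expiD addrC.
- have mu : `|u| = m%:C%C by rewrite um norm_rexpi // ltW.
  have : `|m%:C%C - rho%:C%C| < (e%:C)%C :> R[i].
    rewrite -mu -{1}[rho%:C%C]ger0_norm; last by rewrite lecR ltW.
    apply: le_lt_trans (ler_dist_dist _ _) _.
    have -> : u - rho%:C%C = ((a - rho) +i* b)%C by rewrite uab; apply: eqc; rewrite /= ?subr0.
    by rewrite normc_def ltcR.
  rewrite -rmorphB normc_def ltcR /= expr0n addr0 sqrtr_sqr => h; exact: lt_le_trans h e2.
- rewrite addrAC subrr add0r; apply: le_lt_trans (atan_norm_le _) _.
  rewrite normrM normfV (gtr0_norm a00) ltr_pdivrMr //.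
  apply: lt_le_trans be _; apply: le_trans e3 _; rewrite ler_pM2l //; exact: ltW.
Qed.
End PolarNeighbourhood.

(** * [Theta] and its boundary along the rays of the first arc *)

Section ArcTheta.
Local Open Scope classical_set_scope.
Local Open Scope ring_scope.
Variables (R : realType) (n p q r s : nat).
Implicit Types (theta rho alpha : R).
Hypotheses (q1 : (1 < q)%N) (qs : (q < s)%N) (sn : (s <= n)%N) (n2q : (n < q.*2)%N)
  (det1 : (r * q = p * s + 1)%N).

Local Notation angA theta := (q%:R * theta - 2 * pi * p%:R).
Local Notation angB theta := (2 * pi * r%:R - s%:R * theta).

Lemma arc_sin_gt0 theta : in_arc p q r s theta ->
  [/\ 0 < sin (angA theta), 0 < sin (angB theta) & 0 < sin (angA theta + angB theta)].
Proof.
move=> /(arc_angles q1 qs det1); move: (angA theta) (angB theta) => A B [A0 B0 AB _].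
by split; apply: sin_gt0_pi; apply/andP; split; lra.
Qed.

Lemma arc_fun_mono theta rho rho' : in_arc p q r s theta -> 0 < rho -> rho < rho' ->
  arc_fun q s theta rho < arc_fun q s theta rho'.
Proof.
move=> th r0 rr; have [sA sB _] := arc_sin_gt0 th.
by rewrite !(arc_funE q1 qs det1) ltrD2r; apply: arc_mono => //; apply: ltnW.
Qed.

Lemma arc_f_alpha theta rho alpha : in_arc p q r s theta -> 0 < rho ->
  f_alpha q s alpha (rho%:C%C * expi theta) = 0 <->
  arc_fun q s theta rho = 0 /\ alpha = rho ^+ s * sin (angA theta) / sin (angA theta + angB theta).
Proof.
move=> th rho0; have [sA sB sL] := arc_sin_gt0 th; have [_ e2 e3] := arc_expi q1 qs det1 theta.
have sL0 : sin (angA theta + angB theta) != 0 by rewrite gt_eqF.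
apply: (iff_trans (f_alpha_expi_eq0 alpha qs rho0 e2 e3 sL0)).
rewrite (arc_funE q1 qs det1); split=> [[h1 h2]|[h1 h2]].
  by split; [move: h1; rewrite mulrBl h2; lra | rewrite -h2 mulfK].
have h3 : alpha * sin (angA theta + angB theta) = rho ^+ s * sin (angA theta) by rewrite h2 divfK.
by split=> //; rewrite mulrBl h3; lra.
Qed.

Lemma arc_solution theta : in_arc p q r s theta ->
  exists rho alpha, [/\ 0 < rho < 1, 0 <= alpha <= 1, arc_fun q s theta rho = 0 &
    f_alpha q s alpha (rho%:C%C * expi theta) = 0].
Proof.
move=> th; have [sA sB sL] := arc_sin_gt0 th.
have s0 : (0 < s)%N by apply: leq_trans qs.
(* This makes [arc_fun] positive at radius 1, so its root lies strictly below 1. *)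
have cab : sin (angA theta + angB theta) < sin (angA theta) + sin (angB theta).
  have [A0 B0 AB _] := arc_angles q1 qs det1 th.
  move: A0 B0 AB sA sB; move: (angA theta) (angB theta) => A B A0 B0 AB sA sB.
  have cA : cos A < 1 by rewrite -cos0 ltr_cos // in_itv /=; apply/andP; split; have := @pi_gt0 R; lra.
  have cB : cos B < 1 by rewrite -cos0 ltr_cos // in_itv /=; apply/andP; split; have := @pi_gt0 R; lra.
  by rewrite sinD; nra.
have [rho /andP[r0 r1] E] := arc_root (ltnW q1) s0 sL cab.
pose alpha := rho ^+ s * sin (angA theta) / sin (angA theta + angB theta).
have G0 : arc_fun q s theta rho = 0 by rewrite (arc_funE q1 qs det1) E subrr.
exists rho, alpha; rewrite r0 r1; split=> //; last by apply/(arc_f_alpha _ th r0).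
have a0 : 0 <= alpha by rewrite /alpha !mulr_ge0 ?invr_ge0 ?exprn_ge0 // ltW.
rewrite a0 /alpha ler_pdivrMr // mul1r -E lerDl mulr_ge0 ?exprn_ge0 //; exact: ltW.
Qed.

Lemma Theta_arc theta rho : in_arc p q r s theta -> 0 < rho ->
  Theta n (rho%:C%C * expi theta) <-> arc_fun q s theta rho <= 0.
Proof.
move=> th rho0; split=> [Th|G0].
  have [A0 B0 AB E] := arc_angles q1 qs det1 th; have [e1 e2 _] := arc_expi q1 qs det1 theta.
  have cop : coprime q s.
    by apply/(coprimeP _ (ltnW q1)); exists (r, p); rewrite /= det1 addKn.
  have := Theta_sin_bound q1 qs n2q cop A0 B0 AB E e1 e2 rho0 Th.
  by rewrite (arc_funE q1 qs det1) subr_le0.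
have [rho1 [alpha [/andP[r0 r1] al G1 f0]]] := arc_solution th.
have Th1 := Theta_trinomial (ltnW q1) qs sn al f0.
have rr : rho <= rho1.
  rewrite leNgt; apply/negP => /(arc_fun_mono th r0); rewrite G1; lra.
have -> : rho%:C%C * expi theta = (rho / rho1)%:C%C * (rho1%:C%C * expi theta).
  by rewrite mulrA -rmorphM /= divfK // gt_eqF.
apply: Theta_scale Th1; last first.
  by apply/andP; split; [apply: divr_ge0; exact: ltW | rewrite ler_pdivrMr // mul1r].
(* The point at radius [rho1] differs from 1, because its modulus is below 1. *)
apply/eqP => /(congr1 (fun z : R[i] => `|z|)); rewrite norm_rexpi ?ltW // normr1 => -[h].
by move: r1; rewrite h ltxx.
Qed.

(** The factor [c], taken as 1 or -1, covers both strict signs. Only the angle varies; changes of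
    radius are left to monotonicity. *)
Lemma arc_nbhs theta rho c : in_arc p q r s theta ->
  c * arc_fun q s theta rho < 0 ->
  exists2 d : R, 0 < d & forall theta', `|theta' - theta| < d ->
    in_arc p q r s theta' /\ c * arc_fun q s theta' rho < 0.
Proof.
move=> th G0.
have cont : continuous (fun t : R => c * arc_fun q s t rho).
  move=> t; apply: cvgM; first exact: cvg_cst.
  have cs k : (fun x : R => sin (k%:R * x)) x @[x --> t] --> sin (k%:R * t).
    apply: continuous_comp; last exact: continuous_sin.
    by apply: cvgM; [exact: cvg_cst | exact: cvg_id].
  apply: cvgD; last exact: cs.
  by apply: cvgB; (apply: cvgM; [exact: cvg_cst | exact: cs]).
have : \forall t \near theta, in_arc p q r s t /\ c * arc_fun q s t rho < 0.
  have /andP[h1 h2] := th.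
  near=> t; split; last by near: t; apply: (cvgr_lt _ (cont theta)).
  by apply/andP; split; near: t; [exact: lt_nbhsr | exact: lt_nbhsl].
move=> /nbhs_ballP[d /= d0 H]; exists d => // t td; apply: H.
by rewrite /ball /= distrC.
Unshelve. all: by end_near.
Qed.

(** If [arc_fun] is nonzero at [rho], take [m] halfway between [rho] and the root. The sign at [m]
    persists for nearby angles, and monotonicity in the radius spreads it over a disc around the
    point, which is thus wholly inside or wholly outside [Theta]. At the root the point lies in
    [Theta], and any larger radius leaves it. *)
Lemma boundary_arc theta rho : in_arc p q r s theta -> 0 < rho ->
  boundaryC (@Theta R n) (rho%:C%C * expi theta) <-> arc_fun q s theta rho = 0.
Proof.
move=> th rho0; split=> [bd|G0].
  case: (ltgtP (arc_fun q s theta rho) 0) => // G; exfalso.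
    have [rho1 [alpha [/andP[r0 r1] al G1 f0]]] := arc_solution th.
    have rr : rho < rho1.
      rewrite ltNge; apply/negP; rewrite le_eqVlt => /orP[/eqP h|/(arc_fun_mono th r0)]; last by lra.
      by rewrite -h G1 ltxx in G.
    pose m := (rho + rho1) / 2.
    have Gm : 1 * arc_fun q s theta m < 0.
      by rewrite mul1r -G1; apply: arc_fun_mono => //; rewrite /m; lra.
    have [d d0 H] := arc_nbhs th Gm.
    have dm : 0 < Num.min d (m - rho) by rewrite lt_min d0 /m; lra.
    have [e e0 He] := polar_neighbourhood theta rho0 dm.
    have [_ [w [wT /He [rho' [theta' [wE rho'0]]]]]] := bd e e0.
    rewrite !lt_min => /andP[_ rd] /andP[/H[th' G'] _]; apply: wT; rewrite wE.
    apply/(Theta_arc th' rho'0); rewrite ltW //; rewrite mul1r in G'.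
    by apply: lt_trans G'; apply: arc_fun_mono => //; move: rd; rewrite ltr_norml => /andP[]; lra.
  have [rho1 [alpha [/andP[r0 r1] al G1 f0]]] := arc_solution th.
  have rr : rho1 < rho.
    rewrite ltNge; apply/negP; rewrite le_eqVlt => /orP[/eqP h|/(arc_fun_mono th rho0)]; last by lra.
    by rewrite h G1 ltxx in G.
  pose m := (rho + rho1) / 2.
  have m0 : 0 < m by rewrite /m; lra.
  have Gm : -1 * arc_fun q s theta m < 0.
    by rewrite mulN1r oppr_lt0 -G1; apply: arc_fun_mono => //; rewrite /m; lra.
  have [d d0 H] := arc_nbhs th Gm.
  have dm : 0 < Num.min d (rho - m) by rewrite lt_min d0 /m; lra.
  have [e e0 He] := polar_neighbourhood theta rho0 dm.
  have [[w [wT /He [rho' [theta' [wE rho'0 rd td]]]]] _] := bd e e0.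
  move: rd td; rewrite !lt_min => /andP[_ rd] /andP[/H[th' G'] _]; rewrite wE in wT.
  move: wT => /(Theta_arc th' rho'0); rewrite leNgt => /negP; apply.
  rewrite mulN1r oppr_lt0 in G'; apply: lt_trans G' _.
  by apply: arc_fun_mono => //; move: rd; rewrite ltr_norml => /andP[]; lra.
move=> e e0; split.
  exists (rho%:C%C * expi theta); rewrite subrr normr0 ltcR; split=> //.
  by apply/(Theta_arc th rho0); rewrite G0.
exists ((rho + e / 2)%:C%C * expi theta); split.
  have h : 0 < rho + e / 2 by lra.
  move=> /(Theta_arc th h); apply/negP; rewrite -ltNge -G0.
  by apply: arc_fun_mono => //; lra.
rewrite -mulrBl -rmorphB addrAC subrr add0r norm_rexpi ?ltcR; lra.
Qed.
End ArcTheta.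

(** * Complex conjugation and the second arc *)

Section Conjugation.
Variable R : realType.
Implicit Types (theta rho alpha : R).

Lemma expi_reflect m theta : expi (m%:R * (2 * pi - theta)) = expi (- (m%:R * theta)).
Proof. by rewrite -(expiD2pi (- _) m); congr expi; ring. Qed.

Lemma conjc_rexpi rho theta :
  ((rho%:C * expi theta)^*)%C = rho%:C%C * expi (2 * pi - theta).
Proof.
have := expi_reflect 1 theta; rewrite !mul1r => ->.
by rewrite /expi cosN sinN /=; apply: eqc; ring.
Qed.

Lemma f_alpha_conjc q s alpha (z : R[i]) :
  f_alpha q s alpha (z^*)%C = ((f_alpha q s alpha z)^*)%C.
Proof.
have conjE : forall x : R[i], (x^*)%C = (conjc : {rmorphism R[i] -> R[i]}) x by [].
rewrite /f_alpha !conjE !(rmorphB, rmorphM, rmorphXn) /=.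
by rewrite !oppr0.
Qed.

Lemma boundary_conjc n (z : R[i]) :
  boundaryC (@Theta R n) z -> boundaryC (@Theta R n) (z^*)%C.
Proof.
have nb (w : R[i]) : `|(w^*)%C - (z^*)%C| = `|w - z|.
  have -> : (w^*)%C - (z^*)%C = ((w - z)^*)%C.
    by case: w z => [a b] [c d] /=; rewrite opprD.
  exact: normcJ.
move=> bd e e0; have [[w [wT we]] [v [vT ve]]] := bd e e0; split.
  by exists (w^*)%C; rewrite nb; split; [exact: Theta_conj | exact: we].
exists (v^*)%C; rewrite nb; split; last exact: ve.
by move=> /Theta_conj; rewrite conjcK; exact: vT.
Qed.

Lemma arc_fun_reflect q s theta rho :
  arc_fun q s (2 * pi - theta) rho = - arc_fun q s theta rho.
Proof.
have sE m : sin (m%:R * (2 * pi - theta)) = - sin (m%:R * theta).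
  by have [_ ->] := expi_reflect m theta; rewrite sinN.
by rewrite /arc_fun !sE; ring.
Qed.
End Conjugation.

Lemma arg_qs_reflect (R : realType) p q r s (theta : R) : (p < q)%N -> (r < s)%N ->
  arg_qs p q r s theta -> in_arc p q r s theta \/ in_arc p q r s (2 * pi - theta).
Proof.
move=> pq rs [[h1 h2]|[h1 h2]]; [left|right]; first by rewrite /in_arc h1 h2.
have q0 : q%:R != 0 :> R by rewrite pnatr_eq0; move: pq; lia.
have s0 : s%:R != 0 :> R by rewrite pnatr_eq0; move: rs; lia.
move: h1 h2; rewrite !natrB ?(ltnW pq) ?(ltnW rs) //.
have -> : 2 * pi * (s%:R - r%:R) / s%:R = 2 * pi - 2 * pi * r%:R / s%:R :> R by field.
have -> : 2 * pi * (q%:R - p%:R) / q%:R = 2 * pi - 2 * pi * p%:R / q%:R :> R by field.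
by move=> h1 h2; apply/andP; split; lra.
Qed.

Theorem theorem4p7 (R : realType) (n p q r s : nat) :
  farey_pair n p q r s -> (q < s)%N -> (n %/ q)%N = 1%N ->
  forall theta : R, arg_qs p q r s theta ->
  exists rho alpha : R,
    [/\ 0 < rho <= 1 /\ 0 <= alpha <= 1,
        f_alpha q s alpha ((rho%:C)%C * expi theta) = 0,
        (forall rho' alpha' : R, 0 < rho' <= 1 -> 0 <= alpha' <= 1 ->
           f_alpha q s alpha' ((rho'%:C)%C * expi theta) = 0 ->
           rho' = rho /\ alpha' = alpha),
        rho ^+ s * sin (q%:R * theta) - rho ^+ q * sin (s%:R * theta)
          + sin ((s - q)%:R * theta) = 0 &
        (boundaryC (@Theta R n) ((rho%:C)%C * expi theta) /\
         forall rho' : R, 0 < rho' ->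
           boundaryC (@Theta R n) ((rho'%:C)%C * expi theta) -> rho' = rho)].
Proof.
move=> fp qs nq theta arc.
have [[pq [qn _]] [[rs [sn _]] _]] := fp.
(* If q were 1, then n = 1, against q < s <= n. *)
have q1 : (1 < q)%N.
  by case: q qs nq pq sn {fp arc qn} => [|[|q]] //; rewrite divn1 => h ->; lia.
have n2q : (n < q.*2)%N by have := divn_eq n q; have := ltn_pmod n (ltnW q1); rewrite nq; lia.
have det1 := farey_pair_det q1 qs fp.
(* The second arc is the mirror image of the first under theta -> 2 pi - theta; conjugation
   preserves [Theta] and its boundary and commutes with f_alpha, while [arc_fun] only changes
   sign. *)
wlog th : theta arc / in_arc p q r s theta.
  move=> H; case: (arg_qs_reflect pq rs arc) => th; first exact: H.
  have arc' : arg_qs p q r s (2 * pi - theta) by left; apply/andP.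
  have [rho [alpha [h f0 uniq G0 [bd bdu]]]] := H _ arc' th.
  have thK : 2 * pi - (2 * pi - theta) = theta by ring.
  exists rho, alpha; split; [exact: h | | | |].
  - by rewrite -thK -conjc_rexpi f_alpha_conjc f0 conjc0.
  - move=> rho' alpha' hr ha f0'; apply: (uniq _ _ hr ha).
    by rewrite -conjc_rexpi f_alpha_conjc f0' conjc0.
  - by have := arc_fun_reflect q s theta rho; rewrite /arc_fun G0 => /eqP; rewrite eq_sym oppr_eq0 => /eqP.
  - split; first by rewrite -thK -conjc_rexpi; apply: boundary_conjc.
    move=> rho' rho'0 bd'; apply: (bdu _ rho'0); rewrite -conjc_rexpi; exact: boundary_conjc.
have [rho [alpha [/andP[r0 r1] al G0 f0]]] := arc_solution q1 qs det1 th.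
have uniq rho' : 0 < rho' -> arc_fun q s theta rho' = 0 -> rho' = rho.
  move=> r'0 G0'; case: (ltgtP rho' rho) => // h.
    by have := arc_fun_mono q1 qs det1 th r'0 h; rewrite G0 G0' ltxx.
  by have := arc_fun_mono q1 qs det1 th r0 h; rewrite G0 G0' ltxx.
exists rho, alpha; split; [ | exact: f0 | | exact: G0 |].
- by rewrite r0 ltW.
- move=> rho' alpha' /andP[r'0 _] _ /(arc_f_alpha q1 qs det1 _ th r'0)[G0' ->].
  have rr := uniq _ r'0 G0'; split; [exact: rr | rewrite rr].
  by have /(arc_f_alpha q1 qs det1 _ th r0)[_ ->] := f0.
- split; first by apply/(boundary_arc q1 qs sn n2q det1 th r0).
  by move=> rho' r'0 /(boundary_arc q1 qs sn n2q det1 th r'0); apply: uniq.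
Qed.
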